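(* Whitham's modulated equations associated with the Euler--Korteweg system in Eulerian coordinates and with the Euler--Korteweg system in mass Lagrangian coordinates, i.e. the equations satisfied by the leading-order profiles of formal two-scale expansions whose terms of order $\varepsilon^0$ and $\varepsilon^1$ vanish when inserted in these systems, read respectively as follows. (i) In the Eulerian framework: $$\left\{\begin{array}{l}\partial_TK+\partial_X(\sigma K)=0,\\ \partial_T\langle\rho_0\rangle+\partial_X\langle\rho_0u_0\rangle=0,\\ \partial_T\langle u_0\rangle+\partial_X\langle\tfrac12u_0^2\rangle+\partial_X\langle g_0\rangle=0,\\ \partial_T\langle\rho_0u_0\rangle+\partial_X\Big\langle\rho_0u_0^2+\rho_0g_0+K(\partial_\theta\rho_0)\dfrac{\partial\mathscr E}{\partial\rho_x}(\rho_0,K\partial_\theta\rho_0)-\mathscr E_0\Big\rangle=0,\end{array}\right.$$ and this system is endowed with the additional conservation law (satisfied by all its smooth solutions) $$\partial_T\langle\tfrac12\rho_0u_0^2+\mathscr E_0\rangle+\partial_X\Big\langle\tfrac12\rho_0u_0^3+\rho_0u_0g_0+K\partial_\theta(\rho_0u_0)\dfrac{\partial\mathscr E}{\partial\rho_x}(\rho_0,K\partial_\theta\rho_0)\Big\rangle=0.$$ (ii) In the Lagrangian framework: $$\left\{\begin{array}{l}\partial_Sk-\partial_Y(jk)=0,\\ \partial_S\langle v_0\rangle-\partial_Y\langle w_0\rangle=0,\\ \partial_S\langle w_0\rangle+\partial_Y\langle p_0\rangle=0,\\ \partial_S\langle v_0w_0\rangle+\partial_Y\Big\langle-\tfrac12w_0^2+v_0p_0+\epsilon_0-k(\partial_\theta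 v_0)\dfrac{\partial\epsilon}{\partial v_y}(v_0,k\partial_\theta v_0)\Big\rangle=0,\end{array}\right.$$ and this system is endowed with the additional conservation law (satisfied by all its smooth solutions) $$\partial_S\langle\tfrac12w_0^2+\epsilon_0\rangle+\partial_Y\Big\langle w_0p_0-k(\partial_\theta w_0)\dfrac{\partial\epsilon}{\partial v_y}(v_0,k\partial_\theta v_0)\Big\rangle=0.$$
   Context: **Euler--Korteweg systems.** Eulerian: $\partial_t\rho+\partial_x(\rho u)=0$, $\partial_tu+u\partial_xu+\partial_x(\mathsf E_\rho\mathscr E)=0$, with $\mathscr E=\mathscr E(\rho,\rho_x)$ smooth and $\mathsf E_\rho\mathscr E=\partial\mathscr E/\partial\rho-\mathrm D_x(\partial\mathscr E/\partial\rho_x)$. Mass Lagrangian (time denoted $s$): $\partial_sv=\partial_yu$, $\partial_su=\partial_y(\mathsf E_v\epsilon)$, with $v=1/\rho$, $\epsilon=\epsilon(v,v_y)$ smooth and $\mathsf E_v\epsilon=\partial\epsilon/\partial v-\mathrm D_y(\partial\epsilon/\partial v_y)$; $\mathscr E=\rho\,\epsilon$, i.e. $\mathscr E(\rho,\rho_x)=\rho\,\epsilon(1/\rho,-\rho_x/\rho^3)$. Densities and specific volumes are positive. **Two-scale expansions.** With $T=\varepsilon t$, $X=\varepsilon x$, $S=\varepsilon s$, $Y=\varepsilon y$, one considers formal expansions $$(\rho,u)(t,x)=(\rho_0,u_0)(T,X,\Phi(T,X)/\varepsilon)+\varepsilon(\rho_1,u_1)(T,X,\Phi(T,X)/\varepsilon)+o(\varepsilon),$$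 $$(v,u)(s,y)=(v_0,w_0)(S,Y,\phi(S,Y)/\varepsilon)+\varepsilon(v_1,w_1)(S,Y,\phi(S,Y)/\varepsilon)+o(\varepsilon),$$ with smooth profiles that are $1$-periodic in their third variable $\theta$ and smooth phases $\Phi,\phi$. Notation: $K:=\Phi_X$, $\Omega:=\Phi_T$, $\sigma:=-\Omega/K$; $k:=\phi_Y$, $\omega:=\phi_S$, $j:=\omega/k$ (with $K,k\neq0$). Derivatives act as $\partial_t=\varepsilon\partial_T+\Omega\partial_\theta$, $\partial_x=\varepsilon\partial_X+K\partial_\theta$, $\partial_s=\varepsilon\partial_S+\omega\partial_\theta$, $\partial_y=\varepsilon\partial_Y+k\partial_\theta$. $\langle\cdot\rangle$ is the mean over $\theta\in[0,1]$. The expansions are required to make the terms of order $\varepsilon^0$ and $\varepsilon^1$ in the respective systems vanish identically in $\theta$. **Leading-order (profile) equations.** The vanishing of the order $\varepsilon^0$ terms reads, in the Eulerian case, $$\partial_\theta(\rho_0u_0)-\sigma\partial_\theta\rho_0=0,\quad(u_0-\sigma)\partial_\theta u_0+\partial_\theta g_0=0,$$ and, in the Lagrangian case, $$\partial_\theta w_0-j\partial_\theta v_0=0,\quad j\partial_\theta w_0+\partial_\theta p_0=0,$$ where $$g_0:=\frac{\partial\mathscr E}{\partial\rho}(\rho_0,K\partial_\theta\rho_0)-K\mathrm D_\theta\Big(\frac{\partial\mathscr E}{\partial\rho_x}(\rho_0,K\partial_\theta\rho_0)\Big),\quad p_0:=-\frac{\partial\epsilon}{\partial v}(v_0,k\partial_\theta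 v_0)+k\mathrm D_\theta\Big(\frac{\partial\epsilon}{\partial v_y}(v_0,k\partial_\theta v_0)\Big),$$ and $\mathscr E_0:=\mathscr E(\rho_0,K\partial_\theta\rho_0)$, $\epsilon_0:=\epsilon(v_0,k\partial_\theta v_0)$. A smooth solution of a modulated system means smooth $(K,\sigma,\rho_0,u_0)$ (resp. $(k,j,v_0,w_0)$), $1$-periodic in $\theta$, satisfying these leading-order equations together with the averaged equations. *)

(* Defs.v *)
(* Stdlib reals with Coquelicot. *)
From Stdlib Require Import Reals.
From Coquelicot Require Import Coquelicot.
Open Scope R_scope.

(** * Smooth functions and partial derivatives *)

(* Partial derivatives of a function of two variables. *)
Definition p1 (f : R -> R -> R) (x y : R) : R := Derive (fun x' => f x' y) x.
Definition p2 (f : R -> R -> R) (x y : R) : R := Derive (fun y' => f x y') y.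

(* Fields depend on two slow variables and on the phase variable th; in the
   Eulerian framework the slow variables are (T, X), in the Lagrangian one
   they are (S, Y). *)
Definition field := R -> R -> R -> R.

Definition d1 (f : field) : field := fun T X th => Derive (fun T' => f T' X th) T.
Definition d2 (f : field) : field := fun T X th => Derive (fun X' => f T X' th) X.
Definition d3 (f : field) : field := fun T X th => Derive (fun th' => f T X th') th.

Definition pderiv (a b c : nat) (f : field) : field :=
  Nat.iter a d1 (Nat.iter b d2 (Nat.iter c d3 f)).

(* Three-variable counterpart of Coquelicot's [ex_diff_n]. *)
Fixpoint ex_diff3_n (f : field) (n : nat) (T X th : R) : Prop :=
  continuous (fun p : R * R * R => f (fst (fst p)) (snd (fst p)) (snd p)) (T, X, th) /\
  match n with
  | O => True
  | S m =>
      ex_derive (fun T' => f T' X th) T /\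
      ex_derive (fun X' => f T X' th) X /\
      ex_derive (fun th' => f T X th') th /\
      ex_diff3_n (d1 f) m T X th /\
      ex_diff3_n (d2 f) m T X th /\
      ex_diff3_n (d3 f) m T X th
  end.

(* Meant for open U: the conditions at all points of U then say C^infinity. *)
Definition smooth2 (U : R * R -> Prop) (f : R -> R -> R) : Prop :=
  forall (n : nat) (x y : R), U (x, y) -> ex_diff_n f n x y.

Definition smooth3 (U : R * R -> Prop) (f : field) : Prop :=
  forall (n : nat) (T X th : R), U (T, X) -> ex_diff3_n f n T X th.

(* Energies are smooth functions of a positive density (or specific volume)
   and of its derivative. *)
Definition smooth_energy (F : R -> R -> R) : Prop :=
  smooth2 (fun p => 0 < fst p) F.

Definition smooth_profile (U : R * R -> Prop) (f : field) : Prop :=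
  smooth3 U f /\ forall T X th, U (T, X) -> f T X (th + 1) = f T X th.

Definition positive_profile (U : R * R -> Prop) (f : field) : Prop :=
  forall T X th, U (T, X) -> 0 < f T X th.

Definition mean (f : field) (T X : R) : R := RInt (fun th => f T X th) 0 1.

(** * Two-scale calculus *)

(* Fast derivative k d/dth, for a local wavenumber k. *)
Definition fast (k : R -> R -> R) (f : field) : field :=
  fun T X th => k T X * d3 f T X th.

(* Derivatives of f (eps t) (eps x) (Phi (eps t) (eps x) / eps) with respect
   to t and x, as operators on f in which th is an independent variable. *)
Definition dtime (eps : R) (Phi : R -> R -> R) (f : field) : field :=
  fun T X th => eps * d1 f T X th + fast (p1 Phi) f T X th.
Definition dspace (eps : R) (Phi : R -> R -> R) (f : field) : field :=
  fun T X th => eps * d2 f T X th + fast (p2 Phi) f T X th.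

(* Euler operator dF/dr (r, D r) - D (dF/dr_x (r, D r)) of F = F(r, r_x), for
   a derivation D standing for the space derivative. *)
Definition variational_derivative (D : field -> field) (F : R -> R -> R)
    (r : field) : field := fun T X th =>
  p1 F (r T X th) (D r T X th)
  - D (fun T' X' th' => p2 F (r T' X' th') (D r T' X' th')) T X th.

(* c eps = c0 + eps * c1 + o(eps) as eps -> 0+. *)
Definition expands (c : R -> R) (c0 c1 : R) : Prop :=
  filterlim (fun eps => (c eps - (c0 + eps * c1)) / eps) (at_right 0) (locally 0).

(* f = f0 + eps f1 + o(eps).  As the expansions are formal, they may be
   differentiated: each partial derivative of the remainder is o(eps), at
   each point.  No periodicity is asked of the remainder. *)
Definition profile_expansion (U : R * R -> Prop) (f0 f1 : field)
    (f : R -> field) : Prop :=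
  smooth_profile U f0 /\ smooth_profile U f1 /\
  at_right 0 (fun eps => smooth3 U (f eps)) /\
  forall (a b c : nat) (T X th : R), U (T, X) ->
    expands (fun eps => pderiv a b c (f eps) T X th)
            (pderiv a b c f0 T X th) (pderiv a b c f1 T X th).

(* The terms of order eps^0 and eps^1 of r vanish identically. *)
Definition order01_vanish (U : R * R -> Prop) (r : R -> field) : Prop :=
  forall T X th, U (T, X) -> expands (fun eps => r eps T X th) 0 0.

(** * Eulerian framework *)

(* Left-hand sides of  rho_t + (rho u)_x = 0  and
   u_t + u u_x + (variational derivative of E)_x = 0. *)
Definition euler_mass (Phi : R -> R -> R) (rho u : R -> field) (eps : R) : field :=
  fun T X th =>
    dtime eps Phi (rho eps) T X th
    + dspace eps Phi (fun T' X' th' => rho eps T' X' th' * u eps T' X' th') T X th.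

Definition euler_velocity (E : R -> R -> R) (Phi : R -> R -> R)
    (rho u : R -> field) (eps : R) : field :=
  fun T X th =>
    dtime eps Phi (u eps) T X th
    + u eps T X th * dspace eps Phi (u eps) T X th
    + dspace eps Phi
        (variational_derivative (dspace eps Phi) E (rho eps)) T X th.

Definition euler_expansion (E : R -> R -> R) (U : R * R -> Prop)
    (Phi : R -> R -> R) (rho0 u0 rho1 u1 : field) (rho u : R -> field) : Prop :=
  smooth2 U Phi /\ (forall T X, U (T, X) -> p2 Phi T X <> 0) /\
  positive_profile U rho0 /\
  profile_expansion U rho0 rho1 rho /\ profile_expansion U u0 u1 u /\
  order01_vanish U (euler_mass Phi rho u) /\
  order01_vanish U (euler_velocity E Phi rho u).

Definition euler_g (E K : R -> R -> R) (rho0 : field) : field :=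
  variational_derivative (fast K) E rho0.

Definition euler_profile_equations (U : R * R -> Prop) (E K sigma : R -> R -> R)
    (rho0 u0 : field) : Prop :=
  forall T X th, U (T, X) ->
    d3 (fun T X th => rho0 T X th * u0 T X th) T X th
      - sigma T X * d3 rho0 T X th = 0 /\
    (u0 T X th - sigma T X) * d3 u0 T X th + d3 (euler_g E K rho0) T X th = 0.

Definition euler_averaged_equations (U : R * R -> Prop) (E K sigma : R -> R -> R)
    (rho0 u0 : field) : Prop :=
  let g0 := euler_g E K rho0 in
  forall T X, U (T, X) ->
    p1 K T X + p2 (fun T X => sigma T X * K T X) T X = 0 /\
    p1 (mean rho0) T X
      + p2 (mean (fun T X th => rho0 T X th * u0 T X th)) T X = 0 /\
    p1 (mean u0) T X
      + p2 (mean (fun T X th => / 2 * u0 T X th ^ 2)) T X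
      + p2 (mean g0) T X = 0 /\
    p1 (mean (fun T X th => rho0 T X th * u0 T X th)) T X
      + p2 (mean (fun T X th =>
              rho0 T X th * u0 T X th ^ 2 + rho0 T X th * g0 T X th
              + K T X * d3 rho0 T X th * p2 E (rho0 T X th) (K T X * d3 rho0 T X th)
              - E (rho0 T X th) (K T X * d3 rho0 T X th))) T X = 0.

Definition euler_energy_law (U : R * R -> Prop) (E K : R -> R -> R)
    (rho0 u0 : field) : Prop :=
  let g0 := euler_g E K rho0 in
  forall T X, U (T, X) ->
    p1 (mean (fun T X th =>
          / 2 * rho0 T X th * u0 T X th ^ 2
          + E (rho0 T X th) (K T X * d3 rho0 T X th))) T X
    + p2 (mean (fun T X th =>
            / 2 * rho0 T X th * u0 T X th ^ 3
            + rho0 T X th * u0 T X th * g0 T X th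
            + K T X * d3 (fun T X th => rho0 T X th * u0 T X th) T X th
              * p2 E (rho0 T X th) (K T X * d3 rho0 T X th))) T X = 0.

(** * Mass Lagrangian framework *)

(* v_s - u_y  and  u_s - (variational derivative of e)_y. *)
Definition lagrange_volume (phi : R -> R -> R) (v w : R -> field) (eps : R) : field :=
  fun S Y th => dtime eps phi (v eps) S Y th - dspace eps phi (w eps) S Y th.

Definition lagrange_velocity (e : R -> R -> R) (phi : R -> R -> R)
    (v w : R -> field) (eps : R) : field :=
  fun S Y th =>
    dtime eps phi (w eps) S Y th
    - dspace eps phi (variational_derivative (dspace eps phi) e (v eps)) S Y th.

Definition lagrange_expansion (e : R -> R -> R) (U : R * R -> Prop)
    (phi : R -> R -> R) (v0 w0 v1 w1 : field) (v w : R -> field) : Prop :=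
  smooth2 U phi /\ (forall S Y, U (S, Y) -> p2 phi S Y <> 0) /\
  positive_profile U v0 /\
  profile_expansion U v0 v1 v /\ profile_expansion U w0 w1 w /\
  order01_vanish U (lagrange_volume phi v w) /\
  order01_vanish U (lagrange_velocity e phi v w).

Definition lagrange_p (e k : R -> R -> R) (v0 : field) : field :=
  fun S Y th => - variational_derivative (fast k) e v0 S Y th.

Definition lagrange_profile_equations (U : R * R -> Prop) (e k j : R -> R -> R)
    (v0 w0 : field) : Prop :=
  forall S Y th, U (S, Y) ->
    d3 w0 S Y th - j S Y * d3 v0 S Y th = 0 /\
    j S Y * d3 w0 S Y th + d3 (lagrange_p e k v0) S Y th = 0.

Definition lagrange_averaged_equations (U : R * R -> Prop) (e k j : R -> R -> R)
    (v0 w0 : field) : Prop :=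
  let p0 := lagrange_p e k v0 in
  forall S Y, U (S, Y) ->
    p1 k S Y - p2 (fun S Y => j S Y * k S Y) S Y = 0 /\
    p1 (mean v0) S Y - p2 (mean w0) S Y = 0 /\
    p1 (mean w0) S Y + p2 (mean p0) S Y = 0 /\
    p1 (mean (fun S Y th => v0 S Y th * w0 S Y th)) S Y
      + p2 (mean (fun S Y th =>
              - (/ 2 * w0 S Y th ^ 2) + v0 S Y th * p0 S Y th
              + e (v0 S Y th) (k S Y * d3 v0 S Y th)
              - k S Y * d3 v0 S Y th
                * p2 e (v0 S Y th) (k S Y * d3 v0 S Y th))) S Y = 0.

Definition lagrange_energy_law (U : R * R -> Prop) (e k : R -> R -> R)
    (v0 w0 : field) : Prop :=
  let p0 := lagrange_p e k v0 in
  forall S Y, U (S, Y) ->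
    p1 (mean (fun S Y th =>
          / 2 * w0 S Y th ^ 2 + e (v0 S Y th) (k S Y * d3 v0 S Y th))) S Y
    + p2 (mean (fun S Y th =>
            w0 S Y th * p0 S Y th
            - k S Y * d3 w0 S Y th
              * p2 e (v0 S Y th) (k S Y * d3 v0 S Y th))) S Y = 0.

(* Main.v *)
(* For the exact system the momentum residual is an O(1) combination
   u * (mass residual) + rho * (velocity residual), respectively
   w * (volume residual) + v * (velocity residual), so it is o(eps) as well and
   every averaged equation comes from one conservation law dt q + dx f = o(eps):
   its order-eps term is d_T q0 + d_X f0 + d_theta (Phi_T q1 + Phi_X f1) = 0 with
   a periodic last bracket, which the phase average removes.

   For the energy law, the profile equations say that
   m = rho0 (u0 - sigma) and H = u0^2/2 + g0 - sigma u0 do not depend on theta.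
   With these as multipliers, pointwise in theta,
     energy law = H * mass + m * velocity + sigma * momentum
                  + rho0_theta E_{rho_x} * (K_T + (sigma K)_X)
                  + d_theta (K E_{rho_x} (rho0_T + sigma rho0_X)),
   and it remains to average.  In the Lagrangian framework the multipliers are
   -(p0 + j w0), w0 - j v0, j and v0_theta e_{v_y}. *)
Require Import Defs.
From Stdlib Require Import Reals Lra.
From Coquelicot Require Import Coquelicot.
Open Scope R_scope.

(** The expansions are only pointwise in (T, X, th), the residuals contain three space derivatives
    of the density under a nonlinear energy, and that energy is smooth at positive densities only.
    Hence no truncated series is substituted. A class of families, [two_scale n], carries the
    first-order expansions of a field and of its derivatives up to order n; it is stable under sums,
    products and composition with smooth functions, and a derivative costs one level. A flux in the
    class can be differentiated term by term, which is what a conservation law requires. Periodicity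
    is propagated through the same operations, but for the two coefficients only: this suffices to
    average out the order-eps phase derivative although the remainder need not be periodic. The
    momentum identities are exact in eps because the two-scale operators are derivations; they hold
    near each point, for eps small enough that the density is positive there. The energy laws
    involve fixed profiles. Seen as constant families, these inherit from the same stability rules
    the regularity and periodicity needed to integrate. *)

(* Extending c by its first-order part to eps <= 0 turns expansions into
   derivatives at 0, for which the usual rules are available. *)
Lemma expands_derive (c : R -> R) (c0 c1 : R) :
  expands c c0 c1 <->
  exists C : R -> R, is_derive C 0 c1 /\ C 0 = c0 /\
    at_right 0 (fun eps => c eps = C eps).
Proof.
split.
- intros H.
  exists (fun eps => match Rlt_dec 0 eps with
                     | left _ => c eps | right _ => c0 + eps * c1 end).
  split; [|split].
  + apply is_derive_Reals; intros e he.
    apply filterlim_locally with (eps := mkposreal e he) in H.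
    destruct H as [d Hd]; exists d; intros h hn hd.
    destruct (Rlt_dec 0 0) as [h0|_]; [lra|].
    rewrite Rplus_0_l.
    destruct (Rlt_dec 0 h) as [hp|hp].
    * specialize (Hd h).
      assert (A : ball 0 d h)
        by (unfold ball; simpl; unfold AbsRing_ball, abs, minus, plus, opp; simpl;
            rewrite Ropp_0, Rplus_0_r; exact hd).
      specialize (Hd A hp).
      unfold ball in Hd; simpl in Hd; unfold AbsRing_ball, abs, minus, plus, opp in Hd; simpl
      in Hd.
      replace ((c h - (c0 + 0 * c1)) / h - c1)
        with ((c h - (c0 + h * c1)) / h + - 0) by (field; lra).
      exact Hd.
    * replace ((c0 + h * c1 - (c0 + 0 * c1)) / h - c1) with 0 by (field; lra).
      rewrite Rabs_R0; exact he.
  + destruct (Rlt_dec 0 0); [lra|ring].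
  + exists (mkposreal 1 Rlt_0_1); intros h _ hp.
    destruct (Rlt_dec 0 h); [reflexivity|contradiction].
- intros [C [HC [H0 Hc]]]; subst c0.
  apply filterlim_locally; intros e.
  apply is_derive_Reals in HC.
  destruct (HC e (cond_pos e)) as [d Hd].
  assert (A : at_right 0 (fun x => Rabs x < d)).
  { exists d; intros x hx _.
    unfold ball in hx; simpl in hx; unfold AbsRing_ball, abs, minus, plus, opp in hx; simpl in
    hx.
    rewrite Ropp_0, Rplus_0_r in hx; exact hx. }
  assert (B : at_right 0 (fun x => 0 < x)) by (exists (mkposreal 1 Rlt_0_1); auto).
  generalize (filter_and _ _ (filter_and _ _ A B) Hc).
  apply filter_imp; intros x [[h1 h2] ->].
  unfold ball; simpl; unfold AbsRing_ball, abs, minus, plus, opp; simpl.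
  specialize (Hd x (Rgt_not_eq _ _ h2) h1); rewrite Rplus_0_l in Hd.
  replace ((C x - (C 0 + x * c1)) / x + - 0) with ((C x - C 0) / x - c1) by (field; lra).
  exact Hd.
Qed.

Lemma expands_ext (c c' : R -> R) (c0 c1 : R) :
  at_right 0 (fun eps => c eps = c' eps) -> expands c c0 c1 -> expands c' c0 c1.
Proof.
intros H; apply filterlim_ext_loc.
revert H; apply filter_imp; intros x ->; reflexivity.
Qed.

Lemma expands_const (a : R) : expands (fun _ => a) a 0.
Proof.
apply expands_derive; exists (fun _ => a); split; [|split]; auto.
- apply @is_derive_const.
- apply filter_forall; reflexivity.
Qed.

Lemma expands_eps : expands (fun eps => eps) 0 1.
Proof.
apply expands_derive; exists (fun x => x); split; [|split]; auto.
- apply @is_derive_id.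
- apply filter_forall; reflexivity.
Qed.

Lemma expands_plus (a b : R -> R) (a0 a1 b0 b1 : R) :
  expands a a0 a1 -> expands b b0 b1 ->
  expands (fun x => a x + b x) (a0 + b0) (a1 + b1).
Proof.
intros Ha Hb; apply expands_derive in Ha, Hb; apply expands_derive.
destruct Ha as [A [dA [<- eA]]], Hb as [B [dB [<- eB]]].
exists (fun x => A x + B x); split; [|split]; auto.
- now apply @is_derive_plus.
- generalize (filter_and _ _ eA eB); apply filter_imp; intros x [-> ->]; auto.
Qed.

Lemma expands_mult (a b : R -> R) (a0 a1 b0 b1 : R) :
  expands a a0 a1 -> expands b b0 b1 ->
  expands (fun x => a x * b x) (a0 * b0) (a0 * b1 + a1 * b0).
Proof.
intros Ha Hb; apply expands_derive in Ha, Hb; apply expands_derive.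
destruct Ha as [A [dA [<- eA]]], Hb as [B [dB [<- eB]]].
exists (fun x => A x * B x); split; [|split]; auto.
- rewrite Rplus_comm.
  apply (is_derive_mult A B 0 a1 b1 dA dB); intros; apply Rmult_comm.
- generalize (filter_and _ _ eA eB); apply filter_imp; intros x [-> ->]; auto.
Qed.

Lemma expands_comp (F : R -> R -> R) (a b : R -> R) (a0 a1 b0 b1 l1 l2 : R) :
  differentiable_pt_lim F a0 b0 l1 l2 ->
  expands a a0 a1 -> expands b b0 b1 ->
  expands (fun x => F (a x) (b x)) (F a0 b0) (l1 * a1 + l2 * b1).
Proof.
intros HF Ha Hb; apply expands_derive in Ha, Hb; apply expands_derive.
destruct Ha as [A [dA [<- eA]]], Hb as [B [dB [<- eB]]].
exists (fun x => F (A x) (B x)); split; [|split]; auto.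
- apply is_derive_Reals in dA; apply is_derive_Reals in dB.
  apply is_derive_Reals, derivable_pt_lim_comp_2d; auto.
- generalize (filter_and _ _ eA eB); apply filter_imp; intros x [-> ->]; auto.
Qed.

Lemma at_right_pos : at_right 0 (fun eps => 0 < eps).
Proof. exists (mkposreal 1 Rlt_0_1); auto. Qed.

Lemma expands_lim (c : R -> R) (c0 c1 : R) :
  expands c c0 c1 -> filterlim c (at_right 0) (locally c0).
Proof.
intros H; apply expands_derive in H; destruct H as [C [dC [<- eC]]].
apply filterlim_ext_loc with C.
- revert eC; apply filter_imp; auto.
- assert (HC : continuous C 0) by (apply @ex_derive_continuous; eexists; apply dC).
  intros P HP; destruct (HC P HP) as [d Hd]; exists d; auto.
Qed.

Lemma expands_unique (c : R -> R) (a0 a1 b0 b1 : R) :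
  expands c a0 a1 -> expands c b0 b1 -> a0 = b0 /\ a1 = b1.
Proof.
intros Ha Hb.
assert (E : a0 = b0)
  by (apply (filterlim_locally_unique (F := at_right 0) c);
      eapply expands_lim; eassumption).
split; auto; subst b0.
(* Subtracting the two expansions gives the zero function, so the quotient in [expands] is the
   constant [-(a1 - b1)], which must then tend to 0. *)
assert (H := expands_plus _ _ _ _ _ _ Ha (expands_mult _ _ _ _ _ _ (expands_const (-1)) Hb)).
unfold expands in H.
assert (K : filterlim (fun _ : R => -(a1 - b1)) (at_right 0) (locally 0)).
{ revert H; apply filterlim_ext_loc.
  generalize at_right_pos; apply filter_imp; intros x hx; field; lra. }
assert (K' := filterlim_locally_unique (F := at_right 0) _ _ _ K (filterlim_const _)).
lra.
Qed.

(** * Partial derivatives of fields in a direction *)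

(** Indexing derivatives by a direction lets one statement quantify over all three; points become
    triples so that neighbourhoods and continuity are those of the product space. *)
Inductive dir := I1 | I2 | I3.

Definition at3 (f : field) (p : R * R * R) : R := f (fst (fst p)) (snd (fst p)) (snd p).

Definition coord (i : dir) (p : R * R * R) : R :=
  match i with I1 => fst (fst p) | I2 => snd (fst p) | I3 => snd p end.

Definition move (i : dir) (p : R * R * R) (z : R) : R * R * R :=
  match i with
  | I1 => (z, snd (fst p), snd p)
  | I2 => (fst (fst p), z, snd p)
  | I3 => (fst p, z)
  end.

Definition partial (i : dir) : field -> field :=
  match i with I1 => Defs.d1 | I2 => Defs.d2 | I3 => Defs.d3 end.

Definition ex_partial (i : dir) (f : field) (p : R * R * R) : Prop :=
  ex_derive (fun z => at3 f (move i p z)) (coord i p).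

Lemma at3_partial (i : dir) (f : field) (p : R * R * R) :
  at3 (partial i f) p = Derive (fun z => at3 f (move i p z)) (coord i p).
Proof. destruct i; reflexivity. Qed.

Lemma move_coord (i : dir) (p : R * R * R) : move i p (coord i p) = p.
Proof. destruct i, p as [[]]; reflexivity. Qed.

Lemma locally_move (i : dir) (p : R * R * R) (P : R * R * R -> Prop) :
  locally p P -> locally (coord i p) (fun z => P (move i p z)).
Proof.
intros [d Hd]; exists d; intros z hz; apply Hd.
destruct i; repeat split; simpl; try apply ball_center; exact hz.
Qed.

Lemma partial_ext (i : dir) (f g : field) (p : R * R * R) :
  locally p (fun q => at3 f q = at3 g q) -> at3 (partial i f) p = at3 (partial i g) p.
Proof.
intros H; rewrite 2!at3_partial; apply Derive_ext_loc.
exact (locally_move i p _ H).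
Qed.

Lemma ex_partial_ext (i : dir) (f g : field) (p : R * R * R) :
  locally p (fun q => at3 f q = at3 g q) -> ex_partial i f p -> ex_partial i g p.
Proof.
intros H; apply ex_derive_ext_loc.
exact (locally_move i p _ H).
Qed.

Definition fconst (a : R) : field := fun _ _ _ => a.
Definition fplus (f g : field) : field := fun T X th => f T X th + g T X th.
Definition fmult (f g : field) : field := fun T X th => f T X th * g T X th.
Definition fcomp (F : R -> R -> R) (f g : field) : field :=
  fun T X th => F (f T X th) (g T X th).

Lemma ex_partial_const i a p : ex_partial i (fconst a) p.
Proof. exact (ex_derive_const a (coord i p)). Qed.

Lemma partial_const i a p : at3 (partial i (fconst a)) p = 0.
Proof. rewrite at3_partial; exact (Derive_const a (coord i p)). Qed.

Lemma ex_partial_plus i f g p : ex_partial i f p -> ex_partial i g p -> ex_partial i (fplus f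
    g) p.
Proof. intros Hf Hg; exact (ex_derive_plus _ _ _ Hf Hg). Qed.

Lemma partial_plus i f g p : ex_partial i f p -> ex_partial i g p ->
  at3 (partial i (fplus f g)) p = at3 (partial i f) p + at3 (partial i g) p.
Proof. intros Hf Hg; rewrite !at3_partial; exact (Derive_plus _ _ _ Hf Hg). Qed.

Lemma ex_partial_mult i f g p : ex_partial i f p -> ex_partial i g p -> ex_partial i (fmult f
    g) p.
Proof. intros Hf Hg; exact (ex_derive_mult _ _ _ Hf Hg). Qed.

Lemma partial_mult i f g p : ex_partial i f p -> ex_partial i g p ->
  at3 (partial i (fmult f g)) p = at3 (partial i f) p * at3 g p + at3 f p * at3 (partial i g) p.
Proof.
intros Hf Hg; rewrite !at3_partial.
generalize (Derive_mult _ _ _ Hf Hg); rewrite !move_coord; auto.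
Qed.

Lemma is_partial_comp i F f g p l1 l2 :
  differentiable_pt_lim F (at3 f p) (at3 g p) l1 l2 ->
  ex_partial i f p -> ex_partial i g p ->
  is_derive (fun z => at3 (fcomp F f g) (move i p z)) (coord i p)
    (l1 * at3 (partial i f) p + l2 * at3 (partial i g) p).
Proof.
intros HF Hf Hg; rewrite !at3_partial.
apply is_derive_Reals.
apply (derivable_pt_lim_comp_2d F (fun z => at3 f (move i p z))
         (fun z => at3 g (move i p z))).
- rewrite move_coord; exact HF.
- apply is_derive_Reals, Derive_correct, Hf.
- apply is_derive_Reals, Derive_correct, Hg.
Qed.

(** The chain rule needs genuine differentiability. It follows from the first partial existing
    nearby and being continuous at the point, together with the second partial at the point. *)
Lemma smooth2_diff V F x y : open V -> smooth2 V F -> V (x, y) ->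
  differentiable_pt_lim F x y (p1 F x y) (p2 F x y).
Proof.
intros HV HF Hxy.
apply filterdiff_differentiable_pt_lim.
apply (is_derive_filterdiff F x y (p1 F) (p2 F x y)).
- generalize (HV _ Hxy); apply filter_imp; intros [u v] Huv; simpl.
  apply Derive_correct, (HF 1%nat u v Huv).
- apply Derive_correct, (HF 1%nat x y Hxy).
- apply continuity_2d_pt_filterlim.
  apply (HF 1%nat x y Hxy).
Qed.

Lemma smooth2_p1 V F : smooth2 V F -> smooth2 V (p1 F).
Proof. intros H n x y Hxy; apply (H (S n) x y Hxy). Qed.

Lemma smooth2_p2 V F : smooth2 V F -> smooth2 V (p2 F).
Proof. intros H n x y Hxy; apply (H (S n) x y Hxy). Qed.

Lemma smooth2_continuous V F x y : smooth2 V F -> V (x, y) ->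
  continuous (fun p : R * R => F (fst p) (snd p)) (x, y).
Proof. intros H Hxy; apply continuity_2d_pt_filterlim, (H O x y Hxy). Qed.

Lemma smooth2_Schwarz V F x y : open V -> smooth2 V F -> V (x, y) ->
  p1 (p2 F) x y = p2 (p1 F) x y.
Proof.
intros HV HF Hxy.
apply (Schwarz F x y).
- apply locally_2d_locally.
  generalize (HV _ Hxy); apply filter_imp; intros [u v] Huv; simpl.
  destruct (HF 2%nat u v Huv) as [_ [h1 [h2 [h3 h4]]]].
  repeat split; auto; [apply h4 | apply h3].
- apply (HF 2%nat x y Hxy).
- apply (HF 2%nat x y Hxy).
Qed.

Lemma ex_partial_comp (V : R * R -> Prop) i F f g p :
  open V -> smooth2 V F -> V (at3 f p, at3 g p) ->
  ex_partial i f p -> ex_partial i g p -> ex_partial i (fcomp F f g) p.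
Proof.
intros HV HF Vp xf xg; eexists; apply is_partial_comp; eauto.
apply (smooth2_diff V); auto.
Qed.

Lemma partial_comp (V : R * R -> Prop) i F f g p :
  open V -> smooth2 V F -> V (at3 f p, at3 g p) ->
  ex_partial i f p -> ex_partial i g p ->
  at3 (partial i (fcomp F f g)) p =
  at3 (fcomp (p1 F) f g) p * at3 (partial i f) p + at3 (fcomp (p2 F) f g) p * at3 (partial i g)
      p.
Proof.
intros HV HF Vp xf xg; rewrite (at3_partial i (fcomp F f g)).
apply is_derive_unique, is_partial_comp; auto; apply (smooth2_diff V); auto.
Qed.

Definition fopp (f : field) : field := fun T X th => - f T X th.

Lemma ex_partial_opp i f p : ex_partial i f p -> ex_partial i (fopp f) p.
Proof. intros H; exact (ex_derive_opp _ _ H). Qed.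

Lemma partial_opp i f p : at3 (partial i (fopp f)) p = - at3 (partial i f) p.
Proof. rewrite !at3_partial; exact (Derive_opp _ _). Qed.

(** * Families with a two-scale expansion *)

Definition shift (p : R * R * R) : R * R * R := (fst p, snd p + 1).

Section Families.

Context (U : R * R -> Prop) (U_open : open U).

Definition on (Q : R * R * R -> Prop) : Prop := forall p, U (fst p) -> Q p.

(* Energies are only smooth at positive densities, and a density of the family
   is known to be positive only near each point, for eps small depending on that
   point: hence the order of the quantifiers. *)
Definition near (Q : R -> R * R * R -> Prop) : Prop :=
  on (fun p => at_right 0 (fun eps => locally p (Q eps))).

Definition periodic (f : field) : Prop := on (fun p => at3 f (shift p) = at3 f p).

(** Continuity of [f eps] near each point turns a property of its value at p into one on a
    neighbourhood of p. Periodicity of f0 and f1 serves the phase averages. *)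
Definition two_scale0 (f : R -> field) (f0 f1 : field) : Prop :=
  on (fun p => expands (fun eps => at3 (f eps) p) (at3 f0 p) (at3 f1 p)) /\
  near (fun eps => continuous (at3 (f eps))) /\
  (on (continuous (at3 f0)) /\ on (continuous (at3 f1))) /\
  periodic f0 /\ periodic f1.

(* f = f0 + eps f1 + o(eps) together with n levels of derivatives.  A field is
   handled as the constant family with f1 = 0. *)
Fixpoint two_scale (n : nat) (f : R -> field) (f0 f1 : field) : Prop :=
  two_scale0 f f0 f1 /\
  match n with
  | O => True
  | S m => forall i,
      (near (fun eps => ex_partial i (f eps)) /\ on (ex_partial i f0) /\ on (ex_partial i f1))
      /\
      two_scale m (fun eps => partial i (f eps)) (partial i f0) (partial i f1)
  end.

Lemma on_locally (Q : R * R * R -> Prop) p : on Q -> U (fst p) -> locally p Q.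
Proof.
intros H Hp; destruct (U_open _ Hp) as [d Hd]; exists d; intros q [hq _].
apply H, Hd, hq.
Qed.

Lemma near_imp2 (P Q S : R -> R * R * R -> Prop) :
  (forall eps p, P eps p -> Q eps p -> S eps p) -> near P -> near Q -> near S.
Proof.
intros H HP HQ p Hp; generalize (filter_and _ _ (HP p Hp) (HQ p Hp)).
apply filter_imp; intros eps [A B]; generalize (filter_and _ _ A B).
apply filter_imp; intros q [C D]; auto.
Qed.

Lemma near_imp (P Q : R -> R * R * R -> Prop) :
  (forall eps p, P eps p -> Q eps p) -> near P -> near Q.
Proof. intros H HP; apply (near_imp2 P P); auto. Qed.

Lemma near_and (P Q : R -> R * R * R -> Prop) :
  near P -> near Q -> near (fun eps p => P eps p /\ Q eps p).
Proof. apply near_imp2; auto. Qed.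

Lemma near_locally (P : R -> R * R * R -> Prop) :
  near P -> near (fun eps p => locally p (P eps)).
Proof.
intros H p Hp; generalize (H p Hp); apply filter_imp; intros eps.
apply locally_locally.
Qed.

Lemma near_singleton (P : R -> R * R * R -> Prop) p :
  near P -> U (fst p) -> at_right 0 (fun eps => P eps p).
Proof.
intros H Hp; generalize (H p Hp); apply filter_imp; intros eps; apply locally_singleton.
Qed.

Lemma near_forall (P : R -> R * R * R -> Prop) : (forall eps p, P eps p) -> near P.
Proof. intros H p _; apply filter_forall; intros; apply filter_forall; auto. Qed.

Lemma periodic_partial i f : periodic f -> periodic (partial i f).
Proof.
intros H p Hp; rewrite !at3_partial.
destruct i.
- apply Derive_ext_loc.
  generalize (locally_move I1 p _ (on_locally _ p H Hp)); apply filter_imp; auto.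
- apply Derive_ext_loc.
  generalize (locally_move I2 p _ (on_locally _ p H Hp)); apply filter_imp; auto.
(* In the phase direction the shift moves the base point of the derivative itself, so the difference
   quotients are compared one by one under the limit. *)
- assert (A : forall z, at3 f (move I3 (shift p) (z + 1)) = at3 f (move I3 p z))
    by (intros z; exact (H (move I3 p z) Hp)).
  unfold Derive; f_equal; apply Lim_ext; intros h; cbv beta.
  rewrite <- !A; unfold shift, coord, move; simpl.
  replace (snd p + h + 1) with (snd p + 1 + h) by ring; reflexivity.
Qed.

Lemma two_scale_two_scale0 n f f0 f1 : two_scale n f f0 f1 -> two_scale0 f f0 f1.
Proof. destruct n; intros H; apply H. Qed.

Lemma two_scale_S n f f0 f1 : two_scale (S n) f f0 f1 -> two_scale n f f0 f1.
Proof.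
revert f f0 f1; induction n as [|n IH]; intros f f0 f1 H.
- split; auto; apply H.
- split; [apply H|]; intros i; destruct H as [_ H]; destruct (H i) as [H1 H2].
  split; auto.
Qed.

Lemma two_scale0_ext f f0 f1 g g0 g1 :
  near (fun eps p => at3 (f eps) p = at3 (g eps) p) ->
  on (fun p => at3 f0 p = at3 g0 p) -> on (fun p => at3 f1 p = at3 g1 p) ->
  two_scale0 f f0 f1 -> two_scale0 g g0 g1.
Proof.
intros E E0 E1 [h1 [h2 [[h3 h4] [h5 h6]]]]; repeat split.
- intros p Hp; rewrite <- E0, <- E1 by auto; generalize (h1 p Hp); apply expands_ext.
  apply (near_singleton _ p E Hp).
- refine (near_imp2 _ _ _ _ (near_locally _ E) h2); intros eps p e c.
  unfold continuous; rewrite <- (locally_singleton _ _ e); revert c; apply filterlim_ext_loc;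
      exact e.
- intros p Hp; generalize (h3 p Hp); unfold continuous; rewrite E0 by auto.
  apply filterlim_ext_loc, (on_locally _ p E0 Hp).
- intros p Hp; generalize (h4 p Hp); unfold continuous; rewrite E1 by auto.
  apply filterlim_ext_loc, (on_locally _ p E1 Hp).
- intros p Hp; rewrite <- !E0 by auto; auto.
- intros p Hp; rewrite <- !E1 by auto; auto.
Qed.

(** Sum, product and chain rules hold only where the factors are differentiable, hence near each
    point for small eps. This lemma carries the induction steps below from a derivative computed by
    such a rule to [partial i] of the family. *)
Lemma two_scale_ext n f f0 f1 g g0 g1 :
  near (fun eps p => at3 (f eps) p = at3 (g eps) p) ->
  on (fun p => at3 f0 p = at3 g0 p) -> on (fun p => at3 f1 p = at3 g1 p) ->
  two_scale n f f0 f1 -> two_scale n g g0 g1.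
Proof.
revert f f0 f1 g g0 g1; induction n as [|n IH]; intros f f0 f1 g g0 g1 E E0 E1 H.
all: split; [apply (two_scale0_ext f f0 f1); eauto using two_scale_two_scale0|auto].
intros i; destruct H as [_ H]; destruct (H i) as [[h1 [h2 h3]] h4].
split; [split; [|split]|].
- refine (near_imp2 _ _ _ _ (near_locally _ E) h1); intros eps p; apply ex_partial_ext.
- intros p Hp; apply (ex_partial_ext i f0); auto; apply (on_locally _ p E0 Hp).
- intros p Hp; apply (ex_partial_ext i f1); auto; apply (on_locally _ p E1 Hp).
- revert h4; apply IH.
  + refine (near_imp _ _ _ (near_locally _ E)); intros eps p; apply partial_ext.
  + intros p Hp; apply partial_ext, (on_locally _ p E0 Hp).
  + intros p Hp; apply partial_ext, (on_locally _ p E1 Hp).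
Qed.

(** * Closure of two-scale families under sums, products and composition *)

Lemma two_scale0_const a : two_scale0 (fun _ => fconst a) (fconst a) (fconst 0).
Proof.
repeat split; try (intros p _; apply continuous_const).
- intros p _; apply expands_const.
- apply near_forall; intros; apply continuous_const.
Qed.

Lemma two_scale_const n a : two_scale n (fun _ => fconst a) (fconst a) (fconst 0).
Proof.
revert a; induction n as [|n IH]; intros a.
all: split; [apply two_scale0_const|auto].
intros i; split.
{ split; [|split]; [apply near_forall|..]; repeat intro; apply ex_partial_const. }
generalize (IH 0); apply two_scale_ext; [apply near_forall|..]; repeat intro; rewrite
    partial_const; reflexivity.
Qed.

Lemma two_scale_eps n : two_scale n (fun eps => fconst eps) (fconst 0) (fconst 1).
Proof.
assert (H : two_scale0 (fun eps => fconst eps) (fconst 0) (fconst 1)).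
{ repeat split; try (intros p _; apply continuous_const).
  - intros p _; apply expands_eps.
  - apply near_forall; intros; apply continuous_const. }
destruct n; split; auto.
intros i; split.
{ split; [|split]; [apply near_forall|..]; repeat intro; apply ex_partial_const. }
generalize (two_scale_const n 0); apply two_scale_ext; [apply near_forall|..]; repeat intro;
    rewrite partial_const; reflexivity.
Qed.

Lemma two_scale0_plus f f0 f1 g g0 g1 : two_scale0 f f0 f1 -> two_scale0 g g0 g1 ->
  two_scale0 (fun eps => fplus (f eps) (g eps)) (fplus f0 g0) (fplus f1 g1).
Proof.
intros [a1 [a2 [[a3 a4] [a5 a6]]]] [b1 [b2 [[b3 b4] [b5 b6]]]]; repeat split.
- intros p Hp; exact (expands_plus _ _ _ _ _ _ (a1 p Hp) (b1 p Hp)).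
- refine (near_imp2 _ _ _ _ a2 b2); intros eps p A B.
  exact (continuous_plus _ _ p A B).
- intros p Hp; exact (continuous_plus _ _ p (a3 p Hp) (b3 p Hp)).
- intros p Hp; exact (continuous_plus _ _ p (a4 p Hp) (b4 p Hp)).
- intros p Hp; exact (f_equal2 Rplus (a5 p Hp) (b5 p Hp)).
- intros p Hp; exact (f_equal2 Rplus (a6 p Hp) (b6 p Hp)).
Qed.

Lemma two_scale_plus n f f0 f1 g g0 g1 : two_scale n f f0 f1 -> two_scale n g g0 g1 ->
  two_scale n (fun eps => fplus (f eps) (g eps)) (fplus f0 g0) (fplus f1 g1).
Proof.
revert f f0 f1 g g0 g1; induction n as [|n IH]; intros f f0 f1 g g0 g1 Hf Hg.
all: split; [apply two_scale0_plus; eapply two_scale_two_scale0; eassumption|auto].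
intros i.
destruct Hf as [_ Hf]; destruct (Hf i) as [[c1 [c2 c3]] c4].
destruct Hg as [_ Hg]; destruct (Hg i) as [[e1 [e2 e3]] e4].
split.
- split; [|split].
  + refine (near_imp2 _ _ _ _ c1 e1); intros; apply ex_partial_plus; auto.
  + intros p Hp; apply ex_partial_plus; auto.
  + intros p Hp; apply ex_partial_plus; auto.
- generalize (IH _ _ _ _ _ _ c4 e4); apply two_scale_ext.
  + refine (near_imp2 _ _ _ _ c1 e1); intros; symmetry; apply partial_plus; auto.
  + intros p Hp; symmetry; apply partial_plus; auto.
  + intros p Hp; symmetry; apply partial_plus; auto.
Qed.

Lemma two_scale0_mult f f0 f1 g g0 g1 : two_scale0 f f0 f1 -> two_scale0 g g0 g1 ->
  two_scale0 (fun eps => fmult (f eps) (g eps)) (fmult f0 g0)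
    (fplus (fmult f0 g1) (fmult f1 g0)).
Proof.
intros [a1 [a2 [[a3 a4] [a5 a6]]]] [b1 [b2 [[b3 b4] [b5 b6]]]]; repeat split.
- intros p Hp; exact (expands_mult _ _ _ _ _ _ (a1 p Hp) (b1 p Hp)).
- refine (near_imp2 _ _ _ _ a2 b2); intros eps p A B.
  exact (continuous_mult _ _ p A B).
- intros p Hp; exact (continuous_mult _ _ p (a3 p Hp) (b3 p Hp)).
- intros p Hp; exact (continuous_plus _ _ p (continuous_mult _ _ p (a3 p Hp) (b4 p Hp))
    (continuous_mult _ _ p (a4 p Hp) (b3 p Hp))).
- intros p Hp; exact (f_equal2 Rmult (a5 p Hp) (b5 p Hp)).
- intros p Hp; exact (f_equal2 Rplus (f_equal2 Rmult (a5 p Hp) (b6 p Hp))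
    (f_equal2 Rmult (a6 p Hp) (b5 p Hp))).
Qed.

Lemma two_scale_mult n f f0 f1 g g0 g1 : two_scale n f f0 f1 -> two_scale n g g0 g1 ->
  two_scale n (fun eps => fmult (f eps) (g eps)) (fmult f0 g0)
    (fplus (fmult f0 g1) (fmult f1 g0)).
Proof.
revert f f0 f1 g g0 g1; induction n as [|n IH]; intros f f0 f1 g g0 g1 Hf Hg.
all: split; [apply two_scale0_mult; eapply two_scale_two_scale0; eassumption|auto].
intros i.
(* In the product rule each undifferentiated factor meets a derivative known to n levels only, so it
   is lowered to level n. *)
assert (Hf' := two_scale_S _ _ _ _ Hf); assert (Hg' := two_scale_S _ _ _ _ Hg).
destruct Hf as [_ Hf]; destruct (Hf i) as [[c1 [c2 c3]] c4].
destruct Hg as [_ Hg]; destruct (Hg i) as [[e1 [e2 e3]] e4].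
split.
- split; [|split].
  + refine (near_imp2 _ _ _ _ c1 e1); intros; apply ex_partial_mult; auto.
  + intros p Hp; apply ex_partial_mult; auto.
  + intros p Hp; apply ex_partial_plus; apply ex_partial_mult; auto.
- generalize (two_scale_plus _ _ _ _ _ _ _ (IH _ _ _ _ _ _ c4 Hg') (IH _ _ _ _ _ _ Hf' e4));
    apply two_scale_ext.
  + refine (near_imp2 _ _ _ _ c1 e1); intros; symmetry; apply partial_mult; auto.
  + intros p Hp; symmetry; apply partial_mult; auto.
  + intros p Hp; rewrite partial_plus, !partial_mult by auto using ex_partial_mult.
    unfold fplus, fmult, at3; ring.
Qed.

Lemma filter_open2 {T} (Fl : (T -> Prop) -> Prop) {FF : Filter Fl} (V : R * R -> Prop) (a b : T
    -> R) (a0 b0 : R) :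
  open V -> V (a0, b0) -> filterlim a Fl (locally a0) -> filterlim b Fl (locally b0) ->
  Fl (fun x => V (a x, b x)).
Proof.
intros HV H0 Ha Hb; destruct (HV _ H0) as [d Hd].
generalize (filter_and _ _ (proj1 (filterlim_locally a a0) Ha d) (proj1 (filterlim_locally b
    b0) Hb d)).
apply filter_imp; intros x [A B]; apply Hd; split; auto.
Qed.

(** The values at p converge to a point of the open set V, so they lie in V for small eps; for each
    such eps, continuity of the fields spreads this to a neighbourhood of p, whose size may depend
    on eps. *)
Lemma two_scale0_near (V : R * R -> Prop) f f0 f1 g g0 g1 :
  open V -> on (fun p => V (at3 f0 p, at3 g0 p)) -> two_scale0 f f0 f1 -> two_scale0 g g0 g1 ->
  near (fun eps p => V (at3 (f eps) p, at3 (g eps) p)).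
Proof.
intros HV H0 Hf Hg p Hp.
generalize (filter_and _ _ (near_singleton _ p (proj1 (proj2 Hf)) Hp)
  (near_singleton _ p (proj1 (proj2 Hg)) Hp)).
generalize (filter_open2 _ V _ _ _ _ HV (H0 p Hp) (expands_lim _ _ _ (proj1 Hf p Hp))
    (expands_lim _ _ _ (proj1 Hg p Hp))).
intros A B; generalize (filter_and _ _ A B); apply filter_imp.
intros eps [C [D E]]; apply (filter_open2 _ V _ _ _ _ HV C D E).
Qed.

Lemma two_scale0_comp (V : R * R -> Prop) F f f0 f1 g g0 g1 :
  open V -> smooth2 V F -> on (fun p => V (at3 f0 p, at3 g0 p)) ->
  two_scale0 f f0 f1 -> two_scale0 g g0 g1 ->
  two_scale0 (fun eps => fcomp F (f eps) (g eps)) (fcomp F f0 g0)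
    (fplus (fmult (fcomp (p1 F) f0 g0) f1) (fmult (fcomp (p2 F) f0 g0) g1)).
Proof.
intros HV HF HV0 Hf Hg.
assert (C : forall F f g p, smooth2 V F -> V (at3 f p, at3 g p) ->
  continuous (at3 f) p -> continuous (at3 g) p -> continuous (at3 (fcomp F f g)) p).
{ intros G h k p HG Vp ch ck.
  exact (continuous_comp_2 (at3 h) (at3 k) G p ch ck (smooth2_continuous V G _ _ HG Vp)). }
assert (HVn := two_scale0_near V f f0 f1 g g0 g1 HV HV0 Hf Hg).
destruct Hf as [a1 [a2 [[a3 a4] [a5 a6]]]], Hg as [b1 [b2 [[b3 b4] [b5 b6]]]].
assert (P : forall F, periodic (fcomp F f0 g0)) by
  (intros G p Hp; exact (f_equal2 G (a5 p Hp) (b5 p Hp))).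
repeat split; auto.
- intros p Hp; exact (expands_comp F _ _ _ _ _ _ _ _
    (smooth2_diff V F _ _ HV HF (HV0 p Hp)) (a1 p Hp) (b1 p Hp)).
- refine (near_imp2 _ _ _ _ HVn (near_and _ _ a2 b2)).
  intros eps p A [D E]; apply C; auto.
- intros p Hp; apply C; auto; apply (HV0 p Hp).
- intros p Hp; apply @continuous_plus; apply @continuous_mult; auto;
  apply C; auto using smooth2_p1, smooth2_p2; apply (HV0 p Hp).
- intros p Hp; exact (f_equal2 Rplus (f_equal2 Rmult (P (p1 F) p Hp) (a6 p Hp))
    (f_equal2 Rmult (P (p2 F) p Hp) (b6 p Hp))).
Qed.

Lemma two_scale_comp (V : R * R -> Prop) n F f f0 f1 g g0 g1 :
  open V -> smooth2 V F -> on (fun p => V (at3 f0 p, at3 g0 p)) ->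
  two_scale n f f0 f1 -> two_scale n g g0 g1 ->
  two_scale n (fun eps => fcomp F (f eps) (g eps)) (fcomp F f0 g0)
    (fplus (fmult (fcomp (p1 F) f0 g0) f1) (fmult (fcomp (p2 F) f0 g0) g1)).
Proof.
(* The chain rule brings in [p1 F] and [p2 F], so the induction must hold for all smooth F. *)
intros HV HF HV0; revert F HF.
induction n as [|n IH]; intros F HF Hf Hg.
all: split; [apply (two_scale0_comp V); eauto using two_scale_two_scale0|auto].
intros i.
assert (HVn := two_scale0_near V _ _ _ _ _ _ HV HV0 (two_scale_two_scale0 _ _ _ _ Hf)
    (two_scale_two_scale0 _ _ _ _ Hg)).
assert (Hf' := two_scale_S _ _ _ _ Hf); assert (Hg' := two_scale_S _ _ _ _ Hg).
destruct Hf as [_ Hf]; destruct (Hf i) as [[c1 [c2 c3]] c4].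
destruct Hg as [_ Hg]; destruct (Hg i) as [[e1 [e2 e3]] e4].
assert (X := fun F f g p => ex_partial_comp V i F f g p HV).
assert (D := fun F f g p => partial_comp V i F f g p HV).
assert (cn := near_and _ _ c1 e1).
assert (X1 := smooth2_p1 _ _ HF); assert (X2 := smooth2_p2 _ _ HF).
split.
- split; [|split].
  + refine (near_imp2 _ _ _ _ HVn cn); intros eps p A [B E]; apply X; auto.
  + intros p Hp; apply X; auto; apply (HV0 p Hp).
  + intros p Hp; apply ex_partial_plus; apply ex_partial_mult; auto; apply X; auto; apply (HV0
      p Hp).
- generalize (two_scale_plus _ _ _ _ _ _ _
    (two_scale_mult _ _ _ _ _ _ _ (IH _ X1 Hf' Hg') c4)
    (two_scale_mult _ _ _ _ _ _ _ (IH _ X2 Hf' Hg') e4)); apply two_scale_ext.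
  + refine (near_imp2 _ _ _ _ HVn cn); intros eps p A [B E]; symmetry; apply D; auto.
  + intros p Hp; symmetry; apply D; auto; apply (HV0 p Hp).
  + intros p Hp; specialize (HV0 p Hp); rewrite partial_plus, !partial_mult, !D by auto using
      ex_partial_mult.
    (* Differentiating the first-order coefficient and taking the first-order coefficient of the
       derivative exchange the two mixed derivatives of F. *)
    assert (S := smooth2_Schwarz V F _ _ HV HF HV0).
    unfold fplus, fmult, fcomp, at3 in *; rewrite S; ring.
Qed.

Lemma near_on (Q : R * R * R -> Prop) : on Q -> near (fun _ => Q).
Proof. intros H p Hp; apply filter_forall; intros _; apply (on_locally Q p H Hp). Qed.

(** * Smooth profiles as two-scale families *)

Definition slow (F : R -> R -> R) : field := fun T X _ => F T X.

Lemma smooth2_continuous_slow F : smooth2 U F -> on (continuous (at3 (slow F))).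
Proof.
intros HF [[T X] th] Hp.
apply (continuous_comp fst (fun p : R * R => F (fst p) (snd p))).
- apply continuous_fst.
- apply (smooth2_continuous U F T X HF Hp).
Qed.

Lemma smooth2_ex_partial_slow F i : smooth2 U F -> on (ex_partial i (slow F)).
Proof.
intros HF [[T X] th] Hp; destruct i; unfold ex_partial, at3, slow; simpl.
- apply (HF 1%nat T X Hp).
- apply (HF 1%nat T X Hp).
- apply @ex_derive_const.
Qed.

Lemma two_scale_slow n F : smooth2 U F -> two_scale n (fun _ => slow F) (slow F) (fconst 0).
Proof.
revert F; induction n as [|n IH]; intros F HF.
all: split; [|auto].
1, 2: repeat split; [| | |intros p _; apply continuous_const].
1, 4: intros p _; apply expands_const.
1, 3: apply near_on, smooth2_continuous_slow, HF.
1, 2: apply smooth2_continuous_slow, HF.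
intros i; split.
- split; [apply near_on|split]; try apply smooth2_ex_partial_slow, HF.
  intros p _; apply ex_partial_const.
- assert (H : exists G, smooth2 U G /\ forall p, at3 (partial i (slow F)) p = at3 (slow G) p).
  { destruct i.
    - exists (p1 F); split; [apply smooth2_p1, HF | reflexivity].
    - exists (p2 F); split; [apply smooth2_p2, HF | reflexivity].
    - exists (fun _ _ => 0); split; [|intros p; exact (Derive_const (F (fst (fst p)) (snd (fst
    p))) (snd p))].
      intros m x y _; clear; revert x y.
      (* Stated for every function vanishing pointwise, because the derivatives met in the recursion
         equal 0 only up to extensionality. *)
      assert (A : forall m x y (f : R -> R -> R), (forall x y, f x y = 0) -> ex_diff_n f m x y).
      { clear; induction m as [|m IHm]; intros x y f H; simpl; split; auto.
        1, 2: apply continuity_2d_pt_ext with (fun _ _ => 0); auto; apply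
        continuity_2d_pt_const.
        repeat split.
        1, 2: eapply ex_derive_ext; [|apply (ex_derive_const 0)]; simpl; auto.
        1, 2: apply IHm; intros; erewrite Derive_ext; [apply (Derive_const 0)|]; auto. }
      auto. }
  destruct H as [G [HG E]].
  generalize (IH G HG); apply two_scale_ext.
  + apply near_forall; intros; symmetry; apply E.
  + intros p _; symmetry; apply E.
  + intros p _; rewrite partial_const; reflexivity.
Qed.

Lemma smooth3_continuous f : smooth3 U f -> on (continuous (at3 f)).
Proof. intros H [[T X] th] Hp; exact (proj1 (H O T X th Hp)). Qed.

Lemma smooth3_ex_partial i f : smooth3 U f -> on (ex_partial i f).
Proof.
intros H [[T X] th] Hp; destruct (H 1%nat T X th Hp) as [_ [h1 [h2 [h3 _]]]].
destruct i; auto.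
Qed.

Lemma smooth3_partial i f : smooth3 U f -> smooth3 U (partial i f).
Proof.
intros H n T X th Hp; destruct (H (S n) T X th Hp) as [_ [_ [_ [_ [h1 [h2 h3]]]]]].
destruct i; auto.
Qed.

Lemma continuity_2d_move i j g p : continuous (at3 g) p ->
  continuity_2d_pt (fun u v => at3 g (move i (move j p v) u)) (coord i p) (coord j p).
Proof.
intros H; apply continuity_2d_pt_filterlim; simpl.
rewrite !move_coord.
apply filterlim_comp with (2 := H).
intros P [d Hd]; exists d; intros [u v] [hu hv]; apply Hd; simpl in hu, hv.
destruct i, j; repeat split; simpl; try apply ball_center; auto.
Qed.

(** For two distinct directions the moves commute and the remaining coordinate is frozen, so the
    planar Schwarz theorem applies to the slice [G]. *)
Lemma smooth3_Schwarz i j f : smooth3 U f ->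
  on (fun p => at3 (partial i (partial j f)) p = at3 (partial j (partial i f)) p).
Proof.
intros Hf p Hp.
assert (D : i = j \/ i <> j) by (destruct i, j; auto; right; discriminate).
destruct D as [->|D]; auto.
set (G := fun u v => at3 f (move i (move j p v) u)).
assert (G1 : forall g u v, Derive (fun z => at3 g (move i (move j p v) z)) u =
          at3 (partial i g) (move i (move j p v) u)).
{ intros g u v; rewrite at3_partial; destruct i, j; auto; now destruct D. }
assert (G2 : forall g u v, Derive (fun z => at3 g (move i (move j p z) u)) v =
          at3 (partial j g) (move i (move j p v) u)).
{ intros g u v; rewrite at3_partial; destruct i, j; auto; now destruct D. }
assert (HU : locally (coord i p, coord j p) (fun w => U (fst (move i (move j p (snd w)) (fst
    w))))).
{ destruct (U_open _ Hp) as [d Hd]; exists d; intros [u v] [hu hv]; apply Hd; simpl in hu, hv.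
  destruct i, j; repeat split; simpl; try apply ball_center; auto. }
assert (X1 : forall g, smooth3 U g -> forall u v, U (fst (move i (move j p v) u)) ->
   ex_derive (fun z => at3 g (move i (move j p v) z)) u).
{ intros g Hg u v Huv; generalize (smooth3_ex_partial i g Hg _ Huv); unfold ex_partial.
  destruct i, j; auto. }
assert (X2 : forall g, smooth3 U g -> forall u v, U (fst (move i (move j p v) u)) ->
   ex_derive (fun z => at3 g (move i (move j p z) u)) v).
{ intros g Hg u v Huv; generalize (smooth3_ex_partial j g Hg _ Huv); unfold ex_partial.
  destruct i, j; auto; now destruct D. }
assert (S := Schwarz G (coord i p) (coord j p)).
assert (Hi := smooth3_partial i f Hf); assert (Hj := smooth3_partial j f Hf).
assert (C12 : forall u v, Derive (fun z => Derive (fun t => G z t) v) u =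
  at3 (partial i (partial j f)) (move i (move j p v) u)).
{ intros u v; rewrite <- G1; apply Derive_ext; intros z; apply G2. }
assert (C21 : forall u v, Derive (fun z => Derive (fun t => G t z) u) v =
  at3 (partial j (partial i f)) (move i (move j p v) u)).
{ intros u v; rewrite <- G2; apply Derive_ext; intros z; apply G1. }
rewrite C12, C21, !move_coord in S; apply S.
- apply locally_2d_locally; revert HU; apply filter_imp; intros [u v] Huv; simpl in *.
  repeat split.
  + apply X1; auto.
  + apply X2; auto.
  + eapply ex_derive_ext; [intros z; symmetry; apply G2|]; apply X1; auto.
  + eapply ex_derive_ext; [intros z; symmetry; apply G1|]; apply X2; auto.
- eapply continuity_2d_pt_ext; [intros; symmetry; apply C12|].
  apply continuity_2d_move, smooth3_continuous; auto; apply smooth3_partial; auto.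
- eapply continuity_2d_pt_ext; [intros; symmetry; apply C21|].
  apply continuity_2d_move, smooth3_continuous; auto; apply smooth3_partial; auto.
Qed.

Lemma smooth3_iter n i f : smooth3 U f -> smooth3 U (Nat.iter n (partial i) f).
Proof. intros H; induction n as [|n IH]; simpl; auto; apply smooth3_partial, IH. Qed.

Lemma iter_partial_ext n i f g : on (fun p => at3 f p = at3 g p) ->
  on (fun p => at3 (Nat.iter n (partial i) f) p = at3 (Nat.iter n (partial i) g) p).
Proof.
intros H; induction n as [|n IH]; auto; intros p Hp; simpl.
apply partial_ext, (on_locally _ p IH Hp).
Qed.

Lemma iter_partial_comm n i j f : smooth3 U f ->
  on (fun p => at3 (Nat.iter n (partial i) (partial j f)) p = at3 (partial j (Nat.iter n
      (partial i) f)) p).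
Proof.
intros H; induction n as [|n IH]; intros p Hp; simpl; auto.
rewrite (partial_ext i _ _ p (on_locally _ p IH Hp)).
apply smooth3_Schwarz; auto; apply smooth3_iter, H.
Qed.

(* [pderiv] applies d3 first and d1 last, so closure of expansions under d1 and
   d2 needs the symmetry of mixed derivatives. *)
Lemma pderiv_partial i a b c f : smooth3 U f ->
  on (fun p => at3 (pderiv a b c (partial i f)) p =
    at3 (match i with I1 => pderiv (S a) b c f | I2 => pderiv a (S b) c f
         | I3 => pderiv a b (S c) f end) p).
Proof.
intros H p Hp; unfold pderiv; destruct i; rewrite Nat.iter_succ_r.
- refine (iter_partial_ext a I1 _ _ _ p Hp); intros q Hq.
  rewrite <- (iter_partial_comm b I2 I1) by (auto; apply (smooth3_iter c I3), H).
  revert q Hq; apply (iter_partial_ext b I2); intros q Hq.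
  apply (iter_partial_comm c I3 I1); auto.
- refine (iter_partial_ext a I1 _ _ _ p Hp); apply (iter_partial_ext b I2); intros q Hq.
  apply (iter_partial_comm c I3 I2); auto.
- reflexivity.
Qed.

Lemma smooth_profile_periodic f : smooth_profile U f -> periodic f.
Proof. intros [_ H] [[T X] th] Hp; exact (H T X th Hp). Qed.

Lemma smooth_profile_partial i f : smooth_profile U f -> smooth_profile U (partial i f).
Proof.
intros H; split; [apply smooth3_partial, H|]; intros T X th Hp.
exact (periodic_partial i f (smooth_profile_periodic f H) (T, X, th) Hp).
Qed.

Lemma profile_expansion_partial i f f0 f1 : profile_expansion U f0 f1 f ->
  profile_expansion U (partial i f0) (partial i f1) (fun eps => partial i (f eps)).
Proof.
intros [H0 [H1 [Hs He]]]; split; [|split; [|split]].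
- apply smooth_profile_partial, H0.
- apply smooth_profile_partial, H1.
- revert Hs; apply filter_imp; intros eps; apply smooth3_partial.
- intros a b c T X th Hp.
  assert (D := fun g Hg => pderiv_partial i a b c g Hg (T, X, th) Hp); unfold at3 in D; simpl
      in D.
  rewrite (D f0 (proj1 H0)), (D f1 (proj1 H1)).
  apply expands_ext with (fun eps =>
    match i with I1 => pderiv (S a) b c (f eps) | I2 => pderiv a (S b) c (f eps)
         | I3 => pderiv a b (S c) (f eps) end T X th).
  + revert Hs; apply filter_imp; intros eps Hs; symmetry; apply D, Hs.
  + destruct i; apply He; auto.
Qed.

Lemma two_scale_profile_expansion n f f0 f1 : profile_expansion U f0 f1 f -> two_scale n f f0
    f1.
Proof.
revert f f0 f1; induction n as [|n IH]; intros f f0 f1 H.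
all: assert (H' := H); destruct H' as [[H0 P0] [[H1 P1] [Hs He]]].
all: assert (Hf : two_scale0 f f0 f1).
1, 3: repeat split; try (apply smooth3_continuous; assumption);
  try (apply smooth_profile_periodic; split; assumption);
  [intros [[T X] th] Hp; exact (He O O O T X th Hp)
  |intros p Hp; revert Hs; apply filter_imp; intros eps Hs;
   apply (on_locally _ p (smooth3_continuous _ Hs) Hp)].
all: split; auto.
intros i; split; [|apply IH, profile_expansion_partial, H].
split; [|split]; try (apply smooth3_ex_partial; assumption).
intros p Hp; revert Hs; apply filter_imp; intros eps Hs.
apply (on_locally _ p (smooth3_ex_partial i _ Hs) Hp).
Qed.

Lemma two_scale_profile n f : smooth_profile U f -> two_scale n (fun _ => f) f (fconst 0).
Proof.
revert f; induction n as [|n IH]; intros f Hf.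
all: split; [|auto].
1, 2: repeat split;
  [intros p _; apply expands_const
  |apply near_on, smooth3_continuous, Hf
  |apply smooth3_continuous, Hf
  |intros p _; apply continuous_const
  |apply smooth_profile_periodic, Hf].
intros i; split.
- split; [apply near_on|split]; try (apply smooth3_ex_partial, Hf).
  intros p _; apply ex_partial_const.
- generalize (IH _ (smooth_profile_partial i f Hf)); apply two_scale_ext.
  + apply near_forall; reflexivity.
  + intros p _; reflexivity.
  + intros p _; rewrite partial_const; reflexivity.
Qed.

(** * Phase averages *)

Lemma is_RInt_Rplus (f g : R -> R) (a b lf lg : R) :
  is_RInt f a b lf -> is_RInt g a b lg -> is_RInt (fun x => f x + g x) a b (lf + lg).
Proof. exact (is_RInt_plus f g a b lf lg). Qed.

Lemma is_RInt_Rmult (f : R -> R) (a b k l : R) :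
  is_RInt f a b l -> is_RInt (fun x => k * f x) a b (k * l).
Proof. exact (is_RInt_scal f a b k l). Qed.

(** Relations between means are obtained by assembling, with the two rules above, an integrand that
    vanishes pointwise; this lemma then reads off the relation. *)
Lemma is_RInt_zero (f : R -> R) (a b l : R) :
  (forall x, f x = 0) -> is_RInt f a b l -> l = 0.
Proof.
intros Hf Hl.
rewrite <- (is_RInt_unique (V := R_CompleteNormedModule) _ _ _ _ Hl).
rewrite (RInt_ext (V := R_CompleteNormedModule) _ (fun _ => 0)) by auto.
rewrite (RInt_const (V := R_CompleteNormedModule)); apply (scal_zero_r (V := R_NormedModule)).
Qed.

(** The regularity used to differentiate a mean under the integral sign and to integrate a phase
    derivative over a period. *)
Definition C1 (f : field) : Prop :=
  on (continuous (at3 f)) /\ forall i, on (ex_partial i f) /\ on (continuous (at3 (partial i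
      f))).

Lemma two_scale_C1 n f f0 f1 : two_scale (S n) f f0 f1 -> C1 f0 /\ C1 f1.
Proof.
intros [[_ [_ [[h3 h4] _]]] H].
repeat split; auto; try (apply H).
all: destruct (H i) as [_ h]; apply (two_scale_two_scale0 _ _ _ _ h).
Qed.

Lemma continuous_phase f p : continuous (at3 f) p -> continuous (fun th => at3 f (move I3 p
    th)) (snd p).
Proof.
intros H; apply (continuous_comp (fun th => move I3 p th) (at3 f)).
- intros P [d Hd]; exists d; intros z hz; apply Hd.
  split; [apply ball_center | exact hz].
- change (snd p) with (coord I3 p); rewrite move_coord; exact H.
Qed.

Lemma ex_RInt_phase f T X : on (continuous (at3 f)) -> U (T, X) ->
  ex_RInt (fun th => f T X th) 0 1.
Proof.
intros H Hp; apply (ex_RInt_continuous (V := R_CompleteNormedModule)); intros th _.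
exact (continuous_phase f (T, X, th) (H (T, X, th) Hp)).
Qed.

(** Differentiation under the integral sign in either slow direction; the phase entry 0 in
    [(T, X, 0)] is a placeholder. *)
Lemma is_derive_mean i f T X : i <> I3 -> C1 f -> U (T, X) ->
  is_derive (fun z => RInt (fun th => at3 f (move i (T, X, th) z)) 0 1) (coord i (T, X, 0))
    (RInt (fun th => partial i f T X th) 0 1).
Proof.
intros Hi [c H] Hp; destruct (H i) as [Hd Hc].
assert (Uloc : locally (coord i (T, X, 0)) (fun z => U (fst (move i (T, X, 0) z))))
  by (apply (locally_move i (T, X, 0) (fun p => U (fst p))), (on_locally (fun p => U (fst p)));
      [intros q Hq; exact Hq | exact Hp]).
replace (RInt (fun th => partial i f T X th) 0 1)
  with (RInt (fun t => Derive (fun z => at3 f (move i (T, X, t) z)) (coord i (T, X, 0))) 0 1)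
  by (apply RInt_ext; intros th _; destruct i; [reflexivity | reflexivity | now destruct Hi]).
apply (is_derive_RInt_param (fun z th => at3 f (move i (T, X, th) z))).
- refine (filter_imp _ _ _ Uloc); intros z Hz t _.
  generalize (Hd (move i (T, X, t) z)); unfold ex_partial; destruct i; simpl; auto.
- intros t _.
  apply continuity_2d_pt_ext with (fun u v => at3 (partial i f) (move i (move I3 (T, X, t) v)
      u)).
  + intros u v; rewrite at3_partial; destruct i; auto; now destruct Hi.
  + generalize (continuity_2d_move i I3 (partial i f) (T, X, t) (Hc (T, X, t) Hp)); destruct i;
      auto; now destruct Hi.
- refine (filter_imp _ _ _ Uloc); intros z Hz.
  destruct i; simpl in *; [apply (ex_RInt_phase f z X c Hz) | apply (ex_RInt_phase f T z c Hz)
      | now destruct Hi].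
Qed.

Lemma is_RInt_p1_mean f T X : C1 f -> U (T, X) ->
  is_RInt (fun th => Defs.d1 f T X th) 0 1 (p1 (mean f) T X).
Proof.
intros Hf Hp; assert (D : I1 <> I3) by discriminate.
assert (E : p1 (mean f) T X = RInt (fun th => partial I1 f T X th) 0 1)
  by exact (is_derive_unique _ _ _ (is_derive_mean I1 f T X D Hf Hp)).
rewrite E.
apply (RInt_correct (V := R_CompleteNormedModule)), (ex_RInt_phase (partial I1 f) T X); auto;
    apply Hf.
Qed.

Lemma is_RInt_p2_mean f T X : C1 f -> U (T, X) ->
  is_RInt (fun th => Defs.d2 f T X th) 0 1 (p2 (mean f) T X).
Proof.
intros Hf Hp; assert (D : I2 <> I3) by discriminate.
assert (E : p2 (mean f) T X = RInt (fun th => partial I2 f T X th) 0 1)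
  by exact (is_derive_unique _ _ _ (is_derive_mean I2 f T X D Hf Hp)).
rewrite E.
apply (RInt_correct (V := R_CompleteNormedModule)), (ex_RInt_phase (partial I2 f) T X); auto;
    apply Hf.
Qed.

Lemma is_RInt_d3 f T X : C1 f -> periodic f -> U (T, X) ->
  is_RInt (fun th => Defs.d3 f T X th) 0 1 0.
Proof.
intros [_ H] Hper Hp; destruct (H I3) as [Hd Hc].
replace 0 with (f T X 1 - f T X 0) at 2.
- apply (is_RInt_derive (fun th => f T X th)); intros th _.
  + apply Derive_correct, (Hd (T, X, th) Hp).
  + exact (continuous_phase (partial I3 f) (T, X, th) (Hc (T, X, th) Hp)).
- generalize (Hper (T, X, 0) Hp); unfold at3, shift; simpl.
  rewrite Rplus_0_l; intros ->; ring.
Qed.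

Lemma conservation Phi q q0 q1 f f0 f1 :
  two_scale 1 q q0 q1 -> two_scale 1 f f0 f1 ->
  order01_vanish U (fun eps T X th => dtime eps Phi (q eps) T X th + dspace eps Phi (f eps) T X
      th) ->
  forall T X, U (T, X) ->
    (forall th, p1 Phi T X * Defs.d3 q0 T X th + p2 Phi T X * Defs.d3 f0 T X th = 0) /\
    p1 (mean q0) T X + p2 (mean f0) T X = 0.
Proof.
intros Hq Hf Hr T X Hp.
(* The residual has two expansions: the assumed one, with both coefficients 0, and the one computed
   term by term. Uniqueness equates them. The literal factors 0 and 1 are the coefficients of eps,
   or those of the eps-independent phase derivatives. *)
assert (E : forall th,
  0 = 0 * Defs.d1 q0 T X th + p1 Phi T X * Defs.d3 q0 T X th
      + (0 * Defs.d2 f0 T X th + p2 Phi T X * Defs.d3 f0 T X th) /\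
  0 = 0 * Defs.d1 q1 T X th + 1 * Defs.d1 q0 T X th
      + (p1 Phi T X * Defs.d3 q1 T X th + 0 * Defs.d3 q0 T X th)
      + (0 * Defs.d2 f1 T X th + 1 * Defs.d2 f0 T X th
         + (p2 Phi T X * Defs.d3 f1 T X th + 0 * Defs.d3 f0 T X th))).
{ intros th; apply (expands_unique _ _ _ _ _ (Hr T X th Hp)).
  destruct Hq as [_ Hq], Hf as [_ Hf].
  assert (Eq := fun i => proj1 (two_scale_two_scale0 _ _ _ _ (proj2 (Hq i))) (T, X, th) Hp).
  assert (Ef := fun i => proj1 (two_scale_two_scale0 _ _ _ _ (proj2 (Hf i))) (T, X, th) Hp).
  unfold at3 in Eq, Ef; simpl in Eq, Ef.
  unfold dtime, dspace, fast.
  apply expands_plus; apply expands_plus; apply expands_mult;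
    try apply expands_eps; try apply expands_const.
  - apply (Eq I1).
  - apply (Eq I3).
  - apply (Ef I2).
  - apply (Ef I3). }
split.
- intros th; destruct (E th) as [E0 _]; lra.
- destruct (two_scale_C1 _ _ _ _ Hq) as [cq0 cq1], (two_scale_C1 _ _ _ _ Hf) as [cf0 cf1].
  assert (Pq : periodic q1) by apply (two_scale_two_scale0 _ _ _ _ Hq).
  assert (Pf : periodic f1) by apply (two_scale_two_scale0 _ _ _ _ Hf).
  assert (I := is_RInt_Rplus _ _ _ _ _ _
    (is_RInt_Rplus _ _ _ _ _ _ (is_RInt_p1_mean q0 T X cq0 Hp) (is_RInt_p2_mean f0 T X cf0 Hp))
    (is_RInt_Rplus _ _ _ _ _ _
      (is_RInt_Rmult _ _ _ (p1 Phi T X) _ (is_RInt_d3 q1 T X cq1 Pq Hp))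
      (is_RInt_Rmult _ _ _ (p2 Phi T X) _ (is_RInt_d3 f1 T X cf1 Pf Hp)))).
  apply is_RInt_zero in I; [lra|].
  intros th; destruct (E th) as [_ E1]; lra.
Qed.

Lemma p2_mean_plus f g T X : C1 f -> C1 g -> C1 (fplus f g) -> U (T, X) ->
  p2 (mean (fplus f g)) T X = p2 (mean f) T X + p2 (mean g) T X.
Proof.
intros Hf Hg Hfg Hp.
assert (I := is_RInt_Rplus _ _ _ _ _ _ (is_RInt_p2_mean _ T X Hfg Hp)
  (is_RInt_Rmult _ _ _ (-1) _ (is_RInt_Rplus _ _ _ _ _ _
    (is_RInt_p2_mean f T X Hf Hp) (is_RInt_p2_mean g T X Hg Hp)))).
apply is_RInt_zero in I; [lra|]; intros th.
generalize (partial_plus I2 f g (T, X, th) (proj1 (proj2 Hf I2) (T, X, th) Hp) (proj1 (proj2 Hg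
    I2) (T, X, th) Hp)).
unfold at3; simpl; intros ->; ring.
Qed.

Lemma p2_mean_opp f T X : C1 f -> C1 (fopp f) -> U (T, X) ->
  p2 (mean (fopp f)) T X = - p2 (mean f) T X.
Proof.
intros Hf Hg Hp.
assert (I := is_RInt_Rplus _ _ _ _ _ _ (is_RInt_p2_mean _ T X Hg Hp) (is_RInt_p2_mean f T X Hf
    Hp)).
apply is_RInt_zero in I; [lra|]; intros th.
generalize (partial_opp I2 f (T, X, th)).
unfold at3; simpl; intros ->; ring.
Qed.

Lemma phase_constant f T X : C1 f -> U (T, X) -> (forall th, Defs.d3 f T X th = 0) ->
  forall th, f T X th = f T X 0.
Proof.
intros [_ H] Hp H0 th; destruct (H I3) as [Hd _].
assert (D : forall t, is_derive (fun t => f T X t) t zero).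
{ intros t; change (is_derive (fun t => f T X t) t 0); rewrite <- (H0 t).
  apply Derive_correct, (Hd (T, X, t) Hp). }
destruct (Rtotal_order th 0) as [h|[->|h]]; auto.
- apply (eq_is_derive (fun t => f T X t)); auto.
- symmetry; apply (eq_is_derive (fun t => f T X t)); auto.
Qed.

(** * The averaged equations *)

(** The conservation argument requires that a first-order coefficient exist, regular and periodic,
    but never its value, so it is hidden from here on. *)
Definition expandable (n : nat) (f : R -> field) (f0 : field) : Prop := exists f1, two_scale n
    f f0 f1.

Lemma expandable_ext n f f0 g0 : on (fun p => at3 f0 p = at3 g0 p) -> expandable n f f0 ->
    expandable n f g0.
Proof.
intros H [f1 Hf]; exists f1; revert Hf; apply two_scale_ext; auto.
- apply near_forall; reflexivity.
- intros p _; reflexivity.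
Qed.

Lemma expandable_const n a : expandable n (fun _ => fconst a) (fconst a).
Proof. eexists; apply two_scale_const. Qed.

Lemma expandable_plus n f f0 g g0 : expandable n f f0 -> expandable n g g0 ->
  expandable n (fun eps => fplus (f eps) (g eps)) (fplus f0 g0).
Proof. intros [f1 Hf] [g1 Hg]; eexists; apply two_scale_plus; eassumption. Qed.

Lemma expandable_mult n f f0 g g0 : expandable n f f0 -> expandable n g g0 ->
  expandable n (fun eps => fmult (f eps) (g eps)) (fmult f0 g0).
Proof. intros [f1 Hf] [g1 Hg]; eexists; apply two_scale_mult; eassumption. Qed.

Lemma expandable_opp n f f0 : expandable n f f0 -> expandable n (fun eps => fopp (f eps)) (fopp
    f0).
Proof.
intros Hf; destruct (expandable_mult _ _ _ _ _ (expandable_const n (-1)) Hf) as [f1 H].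
exists f1; revert H; apply two_scale_ext; [apply near_forall|..]; repeat intro; auto;
  unfold at3, fmult, fconst, fopp; ring.
Qed.

Lemma expandable_comp (V : R * R -> Prop) n F f f0 g g0 :
  open V -> smooth2 V F -> on (fun p => V (at3 f0 p, at3 g0 p)) ->
  expandable n f f0 -> expandable n g g0 ->
  expandable n (fun eps => fcomp F (f eps) (g eps)) (fcomp F f0 g0).
Proof. intros HV HF H0 [f1 Hf] [g1 Hg]; eexists; apply (two_scale_comp V); eassumption. Qed.

Lemma expandable_partial n i f f0 : expandable (S n) f f0 -> expandable n (fun eps => partial i
    (f eps)) (partial i f0).
Proof. intros [f1 [_ Hf]]; exists (partial i f1); apply Hf. Qed.

Lemma expandable_slow n F : smooth2 U F -> expandable n (fun _ => slow F) (slow F).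
Proof. intros HF; eexists; apply two_scale_slow, HF. Qed.

Lemma expandable_S n f f0 : expandable (S n) f f0 -> expandable n f f0.
Proof. intros [f1 Hf]; exists f1; apply two_scale_S, Hf. Qed.

Lemma expandable_near n f f0 i : expandable (S n) f f0 -> near (fun eps => ex_partial i (f
    eps)).
Proof. intros [f1 [_ Hf]]; apply (Hf i). Qed.

Lemma expandable_ex_partial n f f0 i : expandable (S n) f f0 -> on (ex_partial i f0).
Proof. intros [f1 [_ Hf]]; apply (Hf i). Qed.

Lemma expandable_C1 n f f0 : expandable (S n) f f0 -> C1 f0.
Proof. intros [f1 Hf]; apply (two_scale_C1 _ _ _ _ Hf). Qed.

Lemma expandable_periodic n f f0 : expandable n f f0 -> periodic f0.
Proof. intros [f1 Hf]; apply (two_scale_two_scale0 _ _ _ _ Hf). Qed.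

Lemma expandable_fast n K f f0 : smooth2 U K -> expandable (S n) f f0 ->
  expandable n (fun eps => fast K (f eps)) (fast K f0).
Proof.
intros HK Hf; exact (expandable_mult n _ (slow K) _ _ (expandable_slow n K HK)
    (expandable_partial n I3 _ _ Hf)).
Qed.

(** The slow part of the derivative carries the factor eps, whose leading coefficient is 0: only the
    fast derivative survives at leading order. *)
Lemma expandable_dspace n Phi f f0 : smooth2 U Phi -> expandable (S n) f f0 ->
  expandable n (fun eps => dspace eps Phi (f eps)) (fast (p2 Phi) f0).
Proof.
intros HPhi Hf.
assert (He : expandable n (fun eps => fconst eps) (fconst 0)) by (eexists; apply two_scale_eps).
generalize (expandable_plus n _ _ _ _ (expandable_mult n _ _ _ _ He (expandable_partial n I2 _
    _ Hf))
  (expandable_fast n _ _ _ (smooth2_p2 _ _ HPhi) Hf)).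
apply expandable_ext; intros p _; unfold at3, fplus, fmult, fconst; ring.
Qed.

Lemma open_half_plane : open (fun p : R * R => 0 < fst p).
Proof.
apply (open_comp fst (fun x => 0 < x)); [intros [x y] _; apply continuous_fst | apply open_gt].
Qed.

(** Two levels are spent, one on [D r] and one on the outer [D]. The derivation is a parameter so
    that both [dspace eps Phi] and the eps-independent [fast K] are covered. *)
Lemma expandable_variational n F D (D0 : field -> field) r r0 :
  smooth_energy F -> on (fun p => 0 < at3 r0 p) ->
  (forall m f f0, expandable (S m) f f0 -> expandable m (fun eps => D eps (f eps)) (D0 f0)) ->
  expandable (S (S n)) r r0 ->
  expandable n (fun eps => variational_derivative (D eps) F (r eps)) (variational_derivative D0
      F r0).
Proof.
intros HF Hpos HD Hr.
assert (HV := open_half_plane).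
assert (HDr := HD _ _ _ Hr).
assert (H1 := expandable_comp _ n (p1 F) _ _ _ _ HV (smooth2_p1 _ _ HF) Hpos
  (expandable_S _ _ _ (expandable_S _ _ _ Hr)) (expandable_S _ _ _ HDr)).
assert (H2 := expandable_comp _ (S n) (p2 F) _ _ _ _ HV (smooth2_p2 _ _ HF) Hpos (expandable_S
    _ _ _ Hr) HDr).
exact (expandable_plus n _ _ _ _ H1 (expandable_opp n _ _ (HD _ _ _ H2))).
Qed.

(** * Exact momentum identities for the two-scale derivatives *)

Definition fsq (u : field) : field := fun T X th => u T X th ^ 2.

(** The power [u ^ 2] computes to [u * (u * 1)], hence the factor [fconst 1]; keeping the power
    makes these fields convertible to those of the averaged equations. *)
Lemma ex_partial_sq i u p : ex_partial i u p -> ex_partial i (fsq u) p.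
Proof. intros H; exact (ex_partial_mult i u (fmult u (fconst 1)) p H (ex_partial_mult _ _ _ _ H
    (ex_partial_const i 1 p))). Qed.

Lemma partial_sq i u p : ex_partial i u p -> at3 (partial i (fsq u)) p = 2 * at3 u p * at3
    (partial i u) p.
Proof.
intros H; change (fsq u) with (fmult u (fmult u (fconst 1))).
rewrite !partial_mult, partial_const by auto using ex_partial_mult, ex_partial_const.
unfold at3, fmult, fconst; ring.
Qed.

Lemma at3_dspace eps Phi f p : at3 (dspace eps Phi f) p =
  eps * at3 (partial I2 f) p + p2 Phi (fst (fst p)) (snd (fst p)) * at3 (partial I3 f) p.
Proof. reflexivity. Qed.

Lemma at3_dtime eps Phi f p : at3 (dtime eps Phi f) p =
  eps * at3 (partial I1 f) p + p1 Phi (fst (fst p)) (snd (fst p)) * at3 (partial I3 f) p.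
Proof. reflexivity. Qed.

(** Momentum flux for an arbitrary derivation: [dspace eps Phi] gives the flux of the exact system,
    [fast K] that of the averaged one. *)
Definition euler_flux (F : R -> R -> R) (D : field -> field) (rho u : field) : field :=
  fplus (fplus (fplus (fmult rho (fsq u)) (fmult rho (variational_derivative D F rho)))
    (fmult (D rho) (fcomp (p2 F) rho (D rho)))) (fopp (fcomp F rho (D rho))).

Definition lagrange_flux (F : R -> R -> R) (D : field -> field) (v w : field) : field :=
  fplus (fplus (fplus (fopp (fmult (fconst (/ 2)) (fsq w)))
    (fmult v (fopp (variational_derivative D F v))))
    (fcomp F v (D v))) (fopp (fmult (D v) (fcomp (p2 F) v (D v)))).

Lemma at3_variational D F r p : at3 (variational_derivative D F r) p =
  at3 (fcomp (p1 F) r (D r)) p - at3 (D (fcomp (p2 F) r (D r))) p.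
Proof. reflexivity. Qed.

(** Write D for [dspace eps Phi], b = D rho, a = F_{rho_x} and V = F_rho - D a. As F depends on x
    through rho and b only, D F = F_rho b + a D b. Hence D (rho V + b a - F) = rho D V + b (V + D a
    - F_rho) = rho D V; the rest is the product rule for rho u. *)
Lemma euler_momentum_identity F eps Phi rho u p :
  smooth_energy F -> 0 < at3 rho p ->
  (forall i, ex_partial i rho p) -> (forall i, ex_partial i u p) ->
  (forall i, ex_partial i (dspace eps Phi rho) p) ->
  (forall i, ex_partial i (variational_derivative (dspace eps Phi) F rho) p) ->
  at3 (dtime eps Phi (fmult rho u)) p + at3 (dspace eps Phi (euler_flux F (dspace eps Phi) rho
      u)) p =
  at3 u p * (at3 (dtime eps Phi rho) p + at3 (dspace eps Phi (fmult rho u)) p)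
  + at3 rho p * (at3 (dtime eps Phi u) p + at3 u p * at3 (dspace eps Phi u) p
     + at3 (dspace eps Phi (variational_derivative (dspace eps Phi) F rho)) p).
Proof.
intros HF Hp xr xu xb xV.
assert (HV := open_half_plane).
assert (xa : forall i, ex_partial i (fcomp (p2 F) rho (dspace eps Phi rho)) p)
  by (intros i; apply (ex_partial_comp _ i _ _ _ p HV (smooth2_p2 _ _ HF)); auto).
assert (xE : forall i, ex_partial i (fcomp F rho (dspace eps Phi rho)) p)
  by (intros i; apply (ex_partial_comp _ i _ _ _ p HV HF); auto).
assert (dE := fun i => partial_comp _ i F rho (dspace eps Phi rho) p HV HF Hp (xr i) (xb i)).
assert (EV := at3_variational (dspace eps Phi) F rho p).
assert (Eb := at3_dspace eps Phi rho p).
rewrite (at3_dspace eps Phi (fcomp (p2 F) rho (dspace eps Phi rho))) in EV.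
unfold euler_flux.
set (V := variational_derivative (dspace eps Phi) F rho) in *.
set (b := dspace eps Phi rho) in *.
set (a := fcomp (p2 F) rho b) in *.
set (e := fcomp F rho b) in *.
rewrite !at3_dspace, !at3_dtime.
rewrite ?partial_plus, ?partial_opp, ?partial_mult, ?partial_sq, !dE by auto 8 using
    ex_partial_plus, ex_partial_mult, ex_partial_opp, ex_partial_sq.
(* Made opaque, these fields survive the unfolding of [at3] as atoms for [ring], linked only through
   [EV] and [Eb]. *)
clearbody V a e; clearbody b.
unfold fsq, fmult, at3 in *.
rewrite EV, Eb; ring.
Qed.

Lemma lagrange_momentum_identity F eps Phi v w p :
  smooth_energy F -> 0 < at3 v p ->
  (forall i, ex_partial i v p) -> (forall i, ex_partial i w p) ->
  (forall i, ex_partial i (dspace eps Phi v) p) ->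
  (forall i, ex_partial i (variational_derivative (dspace eps Phi) F v) p) ->
  at3 (dtime eps Phi (fmult v w)) p + at3 (dspace eps Phi (lagrange_flux F (dspace eps Phi) v
      w)) p =
  at3 w p * (at3 (dtime eps Phi v) p - at3 (dspace eps Phi w) p)
  + at3 v p * (at3 (dtime eps Phi w) p
     - at3 (dspace eps Phi (variational_derivative (dspace eps Phi) F v)) p).
Proof.
intros HF Hp xr xu xb xV.
assert (HV := open_half_plane).
assert (xa : forall i, ex_partial i (fcomp (p2 F) v (dspace eps Phi v)) p)
  by (intros i; apply (ex_partial_comp _ i _ _ _ p HV (smooth2_p2 _ _ HF)); auto).
assert (xE : forall i, ex_partial i (fcomp F v (dspace eps Phi v)) p)
  by (intros i; apply (ex_partial_comp _ i _ _ _ p HV HF); auto).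
assert (dE := fun i => partial_comp _ i F v (dspace eps Phi v) p HV HF Hp (xr i) (xb i)).
assert (EV := at3_variational (dspace eps Phi) F v p).
assert (Eb := at3_dspace eps Phi v p).
rewrite (at3_dspace eps Phi (fcomp (p2 F) v (dspace eps Phi v))) in EV.
unfold lagrange_flux.
set (V := variational_derivative (dspace eps Phi) F v) in *.
set (b := dspace eps Phi v) in *.
set (a := fcomp (p2 F) v b) in *.
set (e := fcomp F v b) in *.
rewrite !at3_dspace, !at3_dtime.
rewrite ?partial_plus, ?partial_opp, ?partial_mult, ?partial_opp, ?partial_sq, ?partial_const,
    !dE
  by auto 8 using ex_partial_plus, ex_partial_mult, ex_partial_opp, ex_partial_sq,
      ex_partial_const.
clearbody V a e; clearbody b.
unfold fsq, fmult, fopp, fconst, at3 in *.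
rewrite EV, Eb; field.
Qed.

Lemma order01_vanish_ext r r' :
  near (fun eps p => at3 (r eps) p = at3 (r' eps) p) ->
  order01_vanish U r -> order01_vanish U r'.
Proof.
intros H Hr T X th Hp; generalize (Hr T X th Hp); apply expands_ext.
exact (near_singleton _ (T, X, th) H Hp).
Qed.

(** Multiplying o(eps) by a family with a finite limit leaves it o(eps): both coefficients of each
    product contain a zero factor. *)
Lemma order01_vanish_lin n f f0 g g0 r s :
  expandable n f f0 -> expandable n g g0 -> order01_vanish U r -> order01_vanish U s ->
  order01_vanish U (fun eps => fplus (fmult (f eps) (r eps)) (fmult (g eps) (s eps))).
Proof.
intros [f1 Hf] [g1 Hg] Hr Hs T X th Hp.
assert (A := expands_plus _ _ _ _ _ _
  (expands_mult _ _ _ _ _ _ (proj1 (two_scale_two_scale0 _ _ _ _ Hf) (T, X, th) Hp) (Hr T X th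
      Hp))
  (expands_mult _ _ _ _ _ _ (proj1 (two_scale_two_scale0 _ _ _ _ Hg) (T, X, th) Hp) (Hs T X th
      Hp))).
rewrite !Rmult_0_r, !Rplus_0_r in A; exact A.
Qed.

Lemma expandable_conservation Phi q q0 f f0 :
  expandable 1 q q0 -> expandable 1 f f0 ->
  order01_vanish U (fun eps => fplus (dtime eps Phi (q eps)) (dspace eps Phi (f eps))) ->
  forall T X, U (T, X) ->
    (forall th, p1 Phi T X * Defs.d3 q0 T X th + p2 Phi T X * Defs.d3 f0 T X th = 0) /\
    p1 (mean q0) T X + p2 (mean f0) T X = 0.
Proof. intros [q1 Hq] [f1 Hf] Hr; apply (conservation Phi q q0 q1 f f0 f1 Hq Hf Hr). Qed.

Lemma expandable_near_pos n r r0 : expandable n r r0 -> on (fun p => 0 < at3 r0 p) ->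
  near (fun eps p => 0 < at3 (r eps) p).
Proof.
intros [r1 Hr] H; apply two_scale_two_scale0 in Hr.
exact (two_scale0_near _ r r0 r1 r r0 r1 open_half_plane H Hr Hr).
Qed.

Lemma near_all_partial n f f0 : expandable (S n) f f0 -> near (fun eps p => forall i,
    ex_partial i (f eps) p).
Proof.
intros H.
refine (near_imp2 _ _ _ _ (expandable_near n f f0 I1 H)
  (near_and _ _ (expandable_near n f f0 I2 H) (expandable_near n f f0 I3 H))).
intros eps p A [B C] []; auto.
Qed.

Lemma expandable_sq n f f0 : expandable n f f0 -> expandable n (fun eps => fsq (f eps)) (fsq
    f0).
Proof.
intros H; exact (expandable_mult n _ _ _ _ H (expandable_mult n _ _ _ _ H (expandable_const n
    1))).
Qed.

Lemma partial_slow3 F p : at3 (partial I3 (slow F)) p = 0.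
Proof. rewrite at3_partial; exact (Derive_const (F (fst (fst p)) (snd (fst p))) (snd p)). Qed.

(** * Equations for the leading-order profiles, with a fixed smooth energy *)

Section Energy.

Context (F : R -> R -> R) (F_smooth : smooth_energy F).

Lemma expandable_energy n (D : R -> field -> field) (D0 : field -> field) r r0 :
  on (fun p => 0 < at3 r0 p) -> expandable n r r0 -> expandable n (fun eps => D eps (r eps))
      (D0 r0) ->
  expandable n (fun eps => fcomp F (r eps) (D eps (r eps))) (fcomp F r0 (D0 r0)) /\
  expandable n (fun eps => fcomp (p2 F) (r eps) (D eps (r eps))) (fcomp (p2 F) r0 (D0 r0)).
Proof.
intros Hpos Hr HD; split; apply (expandable_comp _ n _ _ _ _ _ open_half_plane); auto.
apply smooth2_p2, F_smooth.
Qed.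

Lemma euler_expansion_equations Phi rho0 u0 rho1 u1 rho u :
  euler_expansion F U Phi rho0 u0 rho1 u1 rho u ->
  let K := p2 Phi in
  let sigma := fun T X => - p1 Phi T X / K T X in
  euler_profile_equations U F K sigma rho0 u0 /\
  euler_averaged_equations U F K sigma rho0 u0.
Proof.
intros [HPhi [HK [Hpos [Hrho [Hu [Hmass Hvel]]]]]] K sigma.
assert (Er : forall n, expandable n rho rho0) by (intros n; eexists; apply
    two_scale_profile_expansion, Hrho).
assert (Eu : forall n, expandable n u u0) by (intros n; eexists; apply
    two_scale_profile_expansion, Hu).
assert (Pos : on (fun p => 0 < at3 rho0 p)) by (intros [[T X] th] Hp; exact (Hpos T X th Hp)).
assert (ED : forall n f f0, expandable (S n) f f0 -> expandable n (fun eps => dspace eps Phi (f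
    eps)) (fast K f0))
  by (intros; apply expandable_dspace; auto).
set (g0 := euler_g F K rho0).
assert (EV : forall n, expandable n (fun eps => variational_derivative (dspace eps Phi) F (rho
    eps)) g0)
  by (intros n; exact (expandable_variational n F (fun eps => dspace eps Phi) (fast K) rho rho0
      F_smooth Pos ED (Er _))).
destruct (expandable_energy 1 (fun eps => dspace eps Phi) (fast K) rho rho0 Pos (Er 1%nat) (ED
    _ _ _ (Er 2%nat))) as [EE Ea].
assert (Em := expandable_mult 1 _ _ _ _ (Er _) (Eu _)).
assert (Ek := expandable_mult 1 _ _ _ _ (expandable_const 1 (/ 2)) (expandable_sq 1 _ _ (Eu
    _))).
assert (Ef := expandable_plus 1 _ _ _ _ Ek (EV 1%nat)).
assert (EM : expandable 1 (fun eps => euler_flux F (dspace eps Phi) (rho eps) (u eps))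
    (euler_flux F (fast K) rho0 u0))
  by exact (expandable_plus 1 _ _ _ _ (expandable_plus 1 _ _ _ _ (expandable_plus 1 _ _ _ _
       (expandable_mult 1 _ _ _ _ (Er _) (expandable_sq 1 _ _ (Eu _)))
       (expandable_mult 1 _ _ _ _ (Er _) (EV _)))
       (expandable_mult 1 _ _ _ _ (ED _ _ _ (Er _)) Ea)) (expandable_opp 1 _ _ EE)).
assert (Nr := near_all_partial 0 _ _ (Er 1%nat)); assert (Nu := near_all_partial 0 _ _ (Eu
    1%nat)).
assert (Nb := near_all_partial 0 _ _ (ED 1%nat _ _ (Er _))); assert (NV := near_all_partial 0 _
    _ (EV _)).
assert (Np := expandable_near_pos 0 _ _ (Er _) Pos).
assert (C := expandable_conservation Phi _ _ _ _ (Er _) Em Hmass).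
assert (C' := expandable_conservation Phi _ _ _ _ (Eu _) Ef).
assert (C'' := expandable_conservation Phi _ _ _ _ Em EM).
(* Conservative form of the velocity equation: u times the derivative of u is the derivative of u^2
   / 2. *)
assert (Hv' : order01_vanish U (fun eps => fplus (dtime eps Phi (u eps))
   (dspace eps Phi (fplus (fmult (fconst (/ 2)) (fsq (u eps)))
     (variational_derivative (dspace eps Phi) F (rho eps)))))).
{ revert Hvel; apply order01_vanish_ext; refine (near_imp2 _ _ _ _ Nu NV); intros eps p xu xV.
  change (at3 (dtime eps Phi (u eps)) p + at3 (u eps) p * at3 (dspace eps Phi (u eps)) p
    + at3 (dspace eps Phi (variational_derivative (dspace eps Phi) F (rho eps))) p =
    at3 (dtime eps Phi (u eps)) p + at3 (dspace eps Phi (fplus (fmult (fconst (/ 2)) (fsq (u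
    eps)))
     (variational_derivative (dspace eps Phi) F (rho eps)))) p).
  rewrite !at3_dspace, !partial_plus, !partial_mult, !partial_sq, !partial_const
    by auto using ex_partial_mult, ex_partial_sq, ex_partial_const.
  unfold at3, fconst; field. }
assert (Hm' : order01_vanish U (fun eps => fplus (dtime eps Phi (fmult (rho eps) (u eps)))
   (dspace eps Phi (euler_flux F (dspace eps Phi) (rho eps) (u eps))))).
{ generalize (order01_vanish_lin 0 _ _ _ _ _ _ (Eu _) (Er _) Hmass Hvel).
  apply order01_vanish_ext.
  refine (near_imp2 _ _ _ _ (near_and _ _ Nr Nu)
    (near_and _ _ Np (near_and _ _ Nb NV))).
  intros eps p [xr xu] [hp [xb xV]].
  exact (eq_sym (euler_momentum_identity F eps Phi (rho eps) (u eps) p F_smooth hp xr xu xb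
      xV)). }
specialize (C' Hv'); specialize (C'' Hm').
assert (cu := expandable_C1 _ _ _ (Eu 1%nat)); assert (ck := expandable_C1 _ _ _ Ek).
assert (cV := expandable_C1 _ _ _ (EV 1%nat)).
split.
(* At order zero each conservation law reads Phi_T d_theta q0 + K d_theta f0 = 0. Since Phi_T = -
   sigma K, division by K gives the profile equations. *)
- intros T X th Hp.
  destruct (C T X Hp) as [c _], (C' T X Hp) as [c' _]; specialize (c th); specialize (c' th).
  assert (D : at3 (partial I3 (fplus (fmult (fconst (/ 2)) (fsq u0)) g0)) (T, X, th) =
    u0 T X th * Defs.d3 u0 T X th + Defs.d3 g0 T X th).
  { assert (xu := proj1 (proj2 cu I3) (T, X, th) Hp).
    assert (xV := proj1 (proj2 cV I3) (T, X, th) Hp).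
    rewrite partial_plus, partial_mult, partial_sq, partial_const by auto using
    ex_partial_mult, ex_partial_sq, ex_partial_const.
    unfold at3, fconst; simpl; field. }
  change (Defs.d3 (fplus (fmult (fconst (/ 2)) (fsq u0)) g0) T X th =
    u0 T X th * Defs.d3 u0 T X th + Defs.d3 g0 T X th) in D.
  rewrite D in c'.
  assert (HKp := HK T X Hp); fold K in HKp, c, c'.
  unfold sigma; fold g0; split.
  + change (Defs.d3 (fmult rho0 u0) T X th - - p1 Phi T X / K T X * Defs.d3 rho0 T X th = 0).
    apply Rmult_eq_reg_l with (K T X); auto.
    rewrite Rmult_0_r, <- c; field; auto.
  + apply Rmult_eq_reg_l with (K T X); auto.
    rewrite Rmult_0_r, <- c'; field; auto.
- intros T X Hp; change (euler_g F K rho0) with g0.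
  split; [|split; [|split]].
  (* Since sigma K = - Phi_T, the conservation of waves is the equality of the mixed derivatives of
     Phi. The cancellation of K is valid nearby, where the derivative is taken. *)
  + assert (E : p2 (fun T X => sigma T X * K T X) T X = - p2 (p1 Phi) T X).
    { unfold p2 at 1 2; rewrite <- Derive_opp; apply Derive_ext_loc.
      generalize (locally_move I2 (T, X, 0) _ (on_locally (fun p => U (fst p)) (T, X, 0) (fun q
      Hq => Hq) Hp)).
      apply filter_imp; intros z Hz; assert (h := HK T z Hz).
      unfold sigma; fold K in h; field; auto. }
    rewrite E; unfold K; rewrite (smooth2_Schwarz U Phi T X U_open HPhi Hp); ring.
  + apply (C T X Hp).
  + rewrite Rplus_assoc.
    refine (eq_trans (f_equal (Rplus _) (eq_sym (p2_mean_plus _ g0 T X ck cV (expandable_C1 _ _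
    _ Ef) Hp))) _).
    apply (C' T X Hp).
  + apply (C'' T X Hp).
Qed.

Lemma lagrange_expansion_equations phi v0 w0 v1 w1 v w :
  lagrange_expansion F U phi v0 w0 v1 w1 v w ->
  let k := p2 phi in
  let j := fun S Y => p1 phi S Y / k S Y in
  lagrange_profile_equations U F k j v0 w0 /\
  lagrange_averaged_equations U F k j v0 w0.
Proof.
intros [Hphi [Hk [Hpos [Hv [Hw [Hvol Hvel]]]]]] k j.
assert (Ev : forall n, expandable n v v0) by (intros n; eexists; apply
    two_scale_profile_expansion, Hv).
assert (Ew : forall n, expandable n w w0) by (intros n; eexists; apply
    two_scale_profile_expansion, Hw).
assert (Pos : on (fun p => 0 < at3 v0 p)) by (intros [[S Y] th] Hp; exact (Hpos S Y th Hp)).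
assert (ED : forall n f f0, expandable (S n) f f0 -> expandable n (fun eps => dspace eps phi (f
    eps)) (fast k f0))
  by (intros; apply expandable_dspace; auto).
set (p0 := lagrange_p F k v0).
assert (EV : forall n, expandable n (fun eps => variational_derivative (dspace eps phi) F (v
    eps))
    (variational_derivative (fast k) F v0))
  by (intros n; exact (expandable_variational n F (fun eps => dspace eps phi) (fast k) v v0
      F_smooth Pos ED (Ev _))).
assert (EP : forall n, expandable n (fun eps => fopp (variational_derivative (dspace eps phi) F
    (v eps))) p0)
  by (intros n; exact (expandable_opp n _ _ (EV n))).
destruct (expandable_energy 1 (fun eps => dspace eps phi) (fast k) v v0 Pos (Ev 1%nat) (ED _ _
    _ (Ev 2%nat))) as [EE Ea].
assert (Em := expandable_mult 1 _ _ _ _ (Ev _) (Ew _)).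
assert (Eo := expandable_opp 1 _ _ (Ew _)).
assert (EM : expandable 1 (fun eps => lagrange_flux F (dspace eps phi) (v eps) (w eps))
    (lagrange_flux F (fast k) v0 w0))
  by exact (expandable_plus 1 _ _ _ _ (expandable_plus 1 _ _ _ _ (expandable_plus 1 _ _ _ _
       (expandable_opp 1 _ _ (expandable_mult 1 _ _ _ _ (expandable_const 1 (/ 2))
       (expandable_sq 1 _ _ (Ew _))))
       (expandable_mult 1 _ _ _ _ (Ev _) (EP _))) EE)
       (expandable_opp 1 _ _ (expandable_mult 1 _ _ _ _ (ED _ _ _ (Ev _)) Ea))).
assert (Nv := near_all_partial 0 _ _ (Ev 1%nat)); assert (Nw := near_all_partial 0 _ _ (Ew
    1%nat)).
assert (Nb := near_all_partial 0 _ _ (ED 1%nat _ _ (Ev _))); assert (NV := near_all_partial 0 _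
    _ (EV _)).
assert (Np := expandable_near_pos 0 _ _ (Ev _) Pos).
(* The Lagrangian equations have the form q_s - f_y = 0; moving the sign inside the flux puts them
   in the form that the conservation lemma expects. *)
assert (Opp : forall eps f p, at3 (dspace eps phi (fopp f)) p = - at3 (dspace eps phi f) p)
  by (intros eps f p; rewrite !at3_dspace, !partial_opp; ring).
assert (C := expandable_conservation phi _ _ _ _ (Ev _) Eo).
assert (C' := expandable_conservation phi _ _ _ _ (Ew _) (EP _)).
assert (C'' := expandable_conservation phi _ _ _ _ Em EM).
assert (Hv' : order01_vanish U (fun eps => fplus (dtime eps phi (v eps)) (dspace eps phi (fopp
    (w eps))))).
{ revert Hvol; apply order01_vanish_ext, near_forall; intros eps p.
  exact (f_equal (Rplus _) (eq_sym (Opp eps (w eps) p))). }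
assert (Hw' : order01_vanish U (fun eps => fplus (dtime eps phi (w eps))
   (dspace eps phi (fopp (variational_derivative (dspace eps phi) F (v eps)))))).
{ revert Hvel; apply order01_vanish_ext, near_forall; intros eps p.
  exact (f_equal (Rplus _) (eq_sym (Opp eps _ p))). }
assert (Hm' : order01_vanish U (fun eps => fplus (dtime eps phi (fmult (v eps) (w eps)))
   (dspace eps phi (lagrange_flux F (dspace eps phi) (v eps) (w eps))))).
{ generalize (order01_vanish_lin 0 _ _ _ _ _ _ (Ew _) (Ev _) Hvol Hvel).
  apply order01_vanish_ext.
  refine (near_imp2 _ _ _ _ (near_and _ _ Nv Nw)
    (near_and _ _ Np (near_and _ _ Nb NV))).
  intros eps p [xr xu] [hp [xb xV]].
  exact (eq_sym (lagrange_momentum_identity F eps phi (v eps) (w eps) p F_smooth hp xr xu xb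
      xV)). }
specialize (C Hv'); specialize (C' Hw'); specialize (C'' Hm').
assert (HO : forall S Y th, Defs.d3 (fopp w0) S Y th = - Defs.d3 w0 S Y th)
  by (intros S Y th; exact (partial_opp I3 w0 (S, Y, th))).
split.
- intros S Y th Hp.
  destruct (C S Y Hp) as [c _], (C' S Y Hp) as [c' _]; specialize (c th); specialize (c' th).
  rewrite HO in c.
  assert (Hkp := Hk S Y Hp); fold k in Hkp, c, c'.
  unfold j; fold p0; split; apply Rmult_eq_reg_l with (k S Y); auto.
  + rewrite Rmult_0_r; transitivity (- (p1 phi S Y * Defs.d3 v0 S Y th + k S Y * - Defs.d3 w0 S
      Y th));
      [field; auto | rewrite c; ring].
  + rewrite Rmult_0_r, <- c'; field; auto.
- intros S Y Hp; change (lagrange_p F k v0) with p0.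
  split; [|split; [|split]].
  (* Here j k = phi_S, so the wave equation is again the symmetry of the second derivatives of the
     phase. *)
  + assert (E : p2 (fun S Y => j S Y * k S Y) S Y = p2 (p1 phi) S Y).
    { unfold p2 at 1 2; apply Derive_ext_loc.
      generalize (locally_move I2 (S, Y, 0) _ (on_locally (fun p => U (fst p)) (S, Y, 0) (fun q
      Hq => Hq) Hp)).
      apply filter_imp; intros z Hz; assert (h := Hk S z Hz).
      unfold j; fold k in h; field; auto. }
    rewrite E; unfold k; rewrite (smooth2_Schwarz U phi S Y U_open Hphi Hp); ring.
  + unfold Rminus; rewrite <- (p2_mean_opp w0 S Y); auto.
    * apply (C S Y Hp).
    * apply (expandable_C1 _ _ _ (Ew 1%nat)).
    * apply (expandable_C1 _ _ _ Eo).
  + apply (C' S Y Hp).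
  + apply (C'' S Y Hp).
Qed.

Lemma expandable_fixed_energy n K r : smooth2 U K -> smooth_profile U r -> on (fun p => 0 < at3
    r p) ->
  expandable n (fun _ => fcomp F r (fast K r)) (fcomp F r (fast K r)) /\
  expandable n (fun _ => fcomp (p2 F) r (fast K r)) (fcomp (p2 F) r (fast K r)) /\
  expandable n (fun _ => variational_derivative (fast K) F r) (variational_derivative (fast K)
      F r).
Proof.
intros HK Hr Hpos.
assert (Er : forall n, expandable n (fun _ => r) r) by (intros m; eexists; apply
    two_scale_profile, Hr).
assert (ED : forall m f f0, expandable (S m) f f0 -> expandable m (fun eps => fast K (f eps))
    (fast K f0))
  by (intros; apply expandable_fast; auto).
destruct (expandable_energy n (fun _ => fast K) (fast K) (fun _ => r) r Hpos (Er n) (ED _ _ _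
    (Er _))) as [A B].
split; [exact A | split; [exact B|]].
exact (expandable_variational n F (fun _ => fast K) (fast K) (fun _ => r) r F_smooth Hpos ED
    (Er _)).
Qed.

(* The slow variation of the energy is dual to that of its variables through
   the Euler operator, up to a total phase derivative. *)
Lemma partial_energy i K r p : smooth2 U K -> smooth_profile U r -> on (fun p => 0 < at3 r p) ->
  U (fst p) ->
  let a := fcomp (p2 F) r (fast K r) in
  at3 (partial i (fcomp F r (fast K r))) p =
  at3 (variational_derivative (fast K) F r) p * at3 (partial i r) p
  + at3 (partial i (slow K)) p * at3 (partial I3 r) p * at3 a p
  + at3 (partial I3 (fmult (fmult (slow K) a) (partial i r))) p.
Proof.
intros HK Hr Hpos Hp a.
assert (xr : forall f, smooth_profile U f -> forall i, ex_partial i f p)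
  by (intros f Hf l; exact (smooth3_ex_partial l f (proj1 Hf) p Hp)).
assert (xK : forall i, ex_partial i (slow K) p) by (intros l; apply smooth2_ex_partial_slow;
    auto).
assert (HR := smooth_profile_partial I3 r Hr); assert (Hi := smooth_profile_partial i r Hr).
destruct (expandable_fixed_energy 1 K r HK Hr Hpos) as [_ [Ea _]].
assert (xa := fun i => expandable_ex_partial _ _ _ i Ea p Hp); fold a in xa.
change (fast K r) with (fmult (slow K) (partial I3 r)) in *.
rewrite (partial_comp _ i F _ _ p open_half_plane F_smooth (Hpos p Hp)) by auto using
    ex_partial_mult.
rewrite !partial_mult, partial_slow3 by auto using ex_partial_mult.
(* Exchanging the slow and the phase derivative of r exposes K a d_theta (d_i r), which is completed
   to a total phase derivative at the price of the Euler term - K (d_theta a) d_i r. *)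
rewrite (smooth3_Schwarz i I3 r (proj1 Hr) p Hp).
rewrite at3_variational.
change (at3 (fast K (fcomp (p2 F) r (fast K r))) p) with (at3 (slow K) p * at3 (partial I3 a)
    p).
change (fast K r) with (fmult (slow K) (partial I3 r)).
fold a; unfold fmult at 3; unfold at3; ring.
Qed.

(** * The energy laws *)

Lemma euler_energy_equation K sigma rho0 u0 :
  smooth2 U K -> smooth2 U sigma -> smooth_profile U rho0 -> smooth_profile U u0 ->
  positive_profile U rho0 ->
  euler_profile_equations U F K sigma rho0 u0 ->
  euler_averaged_equations U F K sigma rho0 u0 ->
  euler_energy_law U F K rho0 u0.
Proof.
intros HK Hs Hr Hu Hpos Hprof Havg.
assert (Pos : on (fun p => 0 < at3 rho0 p)) by (intros [[T X] th] Hp; exact (Hpos T X th Hp)).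
assert (Er : forall n, expandable n (fun _ => rho0) rho0) by (intros; eexists; apply
    two_scale_profile, Hr).
assert (Eu : forall n, expandable n (fun _ => u0) u0) by (intros; eexists; apply
    two_scale_profile, Hu).
assert (EK : forall n, expandable n (fun _ => slow K) (slow K)) by (intros; apply
    expandable_slow, HK).
assert (Es : forall n, expandable n (fun _ => slow sigma) (slow sigma)) by (intros; apply
    expandable_slow, Hs).
destruct (expandable_fixed_energy 1 K rho0 HK Hr Pos) as [EE [Ea Eg]].
assert (dE := fun i => partial_energy i K rho0).
set (g := variational_derivative (fast K) F rho0) in *.
set (a := fcomp (p2 F) rho0 (fast K rho0)) in *.
set (e := fcomp F rho0 (fast K rho0)) in *.
assert (ER := expandable_partial 1 I3 _ _ (Er 2%nat)).
assert (Em := expandable_mult 2 _ _ _ _ (Er _) (Eu _)).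
assert (Edm := expandable_partial 1 I3 _ _ Em).
assert (Em1 := expandable_mult 1 _ _ _ _ (Er _) (Eu _)).
assert (Eusq := expandable_sq 1 _ _ (Eu _)).
assert (Ec := expandable_const 1 (/ 2)).
assert (Ek := expandable_mult 1 _ _ _ _ Ec Eusq).
assert (EB := fun i => expandable_mult 1 _ _ _ _ (expandable_mult 1 _ _ _ _ (EK 1%nat) Ea)
    (expandable_partial 1 i _ _ (Er 2%nat))).
assert (EM : expandable 1 (fun _ => euler_flux F (fast K) rho0 u0) (euler_flux F (fast K) rho0
    u0))
  by exact (expandable_plus 1 _ _ _ _ (expandable_plus 1 _ _ _ _ (expandable_plus 1 _ _ _ _
       (expandable_mult 1 _ _ _ _ (Er _) Eusq) (expandable_mult 1 _ _ _ _ (Er _) Eg))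
       (expandable_mult 1 _ _ _ _ (expandable_mult 1 _ _ _ _ (EK 1%nat) ER) Ea))
       (expandable_opp 1 _ _ EE)).
assert (Een := expandable_plus 1 _ _ _ _ (expandable_mult 1 _ _ _ _ (expandable_mult 1 _ _ _ _
    Ec (Er _)) Eusq) EE).
assert (EQ := expandable_plus 1 _ _ _ _ (expandable_plus 1 _ _ _ _
   (expandable_mult 1 _ _ _ _ (expandable_mult 1 _ _ _ _ Ec (Er _)) (expandable_mult 1 _ _ _ _
       (Eu _) Eusq))
   (expandable_mult 1 _ _ _ _ (expandable_mult 1 _ _ _ _ (Er _) (Eu _)) Eg))
   (expandable_mult 1 _ _ _ _ (expandable_mult 1 _ _ _ _ (EK 1%nat) Edm) Ea)).
assert (EH := expandable_plus 1 _ _ _ _ (expandable_plus 1 _ _ _ _ Ek Eg) (expandable_opp 1 _ _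
    (expandable_mult 1 _ _ _ _ (Es 1%nat) (Eu _)))).
assert (En := expandable_mult 1 _ _ _ _ (Er 1%nat) (expandable_plus 1 _ _ _ _ (Eu _)
    (expandable_opp 1 _ _ (Es 1%nat)))).
set (M := euler_flux F (fast K) rho0 u0) in *.
set (H := fplus (fplus (fmult (fconst (/ 2)) (fsq u0)) g) (fopp (fmult (slow sigma) u0))) in *.
set (m := fmult rho0 (fplus u0 (fopp (slow sigma)))) in *.
set (en := fplus (fmult (fmult (fconst (/ 2)) rho0) (fsq u0)) e) in *.
set (Q := fplus _ _) in EQ.
set (B := fun i => fmult (fmult (slow K) a) (partial i rho0)) in *.
assert (X : forall p, U (fst p) -> forall i,
  ex_partial i rho0 p /\ ex_partial i u0 p /\ ex_partial i (slow K) p /\ ex_partial i (slow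
      sigma) p /\
  ex_partial i e p /\ ex_partial i a p /\ ex_partial i g p /\ ex_partial i (partial I3 rho0) p).
{ intros p Hp i; repeat split.
  - apply (expandable_ex_partial _ _ _ i (Er 1%nat) p Hp).
  - apply (expandable_ex_partial _ _ _ i (Eu 1%nat) p Hp).
  - apply (expandable_ex_partial _ _ _ i (EK 1%nat) p Hp).
  - apply (expandable_ex_partial _ _ _ i (Es 1%nat) p Hp).
  - apply (expandable_ex_partial _ _ _ i EE p Hp).
  - apply (expandable_ex_partial _ _ _ i Ea p Hp).
  - apply (expandable_ex_partial _ _ _ i Eg p Hp).
  - apply (expandable_ex_partial _ _ _ i ER p Hp). }
assert (Prof : forall p, U (fst p) ->
  at3 (partial I3 (fmult rho0 u0)) p = at3 (slow sigma) p * at3 (partial I3 rho0) p /\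
  (at3 u0 p - at3 (slow sigma) p) * at3 (partial I3 u0) p + at3 (partial I3 g) p = 0).
{ intros [[T X'] th] Hp; destruct (Hprof T X' th Hp) as [h1 h2]; split; [|exact h2].
  apply Rminus_diag_uniq; exact h1. }
assert (H3 : forall p, U (fst p) -> at3 (partial I3 H) p = 0).
{ intros p Hp; destruct (Prof p Hp) as [_ h]; destruct (X p Hp I3) as (xr & xu & xK & xs & xe &
    xa & xg & xR).
  unfold H.
  rewrite !partial_plus, partial_opp, !partial_mult, partial_sq, partial_const, partial_slow3
    by auto 8 using ex_partial_plus, ex_partial_mult, ex_partial_sq, ex_partial_const,
    ex_partial_opp.
  apply (eq_trans (y := (at3 u0 p - at3 (slow sigma) p) * at3 (partial I3 u0) p + at3 (partial
      I3 g) p)); auto.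
  unfold at3, fconst; field. }
assert (m3 : forall p, U (fst p) -> at3 (partial I3 m) p = 0).
{ intros p Hp; destruct (Prof p Hp) as [h _]; destruct (X p Hp I3) as (xr & xu & xK & xs & xe &
    xa & xg & xR).
  revert h; unfold m.
  rewrite !partial_mult, partial_plus, partial_opp, partial_slow3
    by auto 8 using ex_partial_plus, ex_partial_opp.
  unfold fplus, fopp, at3; intros h; lra. }
(* The mass profile equation replaces d_theta (rho0 u0) by sigma d_theta rho0 in the energy flux. It
   holds on a neighbourhood, so this may be done before the slow derivative, which avoids mixed
   derivatives of rho0 u0. *)
assert (Q2 : forall p, U (fst p) -> at3 (partial I2 Q) p =
  at3 (partial I2 (fplus (fplus (fmult (fmult (fconst (/ 2)) rho0) (fmult u0 (fsq u0))) (fmult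
      (fmult rho0 u0) g))
    (fmult (fmult (slow K) (fmult (slow sigma) (partial I3 rho0))) a))) p).
{ intros p Hp; apply partial_ext, on_locally; auto; intros q Hq; destruct (Prof q Hq) as [h _].
  exact (f_equal (fun z => at3 (fplus (fmult (fmult (fconst (/ 2)) rho0) (fmult u0 (fsq u0)))
      (fmult (fmult rho0 u0) g)) q
    + at3 (slow K) q * z * at3 a q) h). }
(* The term in K_T + (sigma K)_X is absent because the hypothesis sets it to 0. The total phase
   derivative is split between [B I1] and [B I2], sigma being independent of th. *)
assert (Id : forall p, U (fst p) ->
  at3 (partial I1 (slow K)) p + at3 (partial I2 (fmult (slow sigma) (slow K))) p = 0 ->
  at3 (partial I1 en) p + at3 (partial I2 Q) p =
  at3 H p * (at3 (partial I1 rho0) p + at3 (partial I2 (fmult rho0 u0)) p)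
  + at3 m p * (at3 (partial I1 u0) p + at3 (partial I2 (fmult (fconst (/ 2)) (fsq u0))) p + at3
      (partial I2 g) p)
  + at3 (slow sigma) p * (at3 (partial I1 (fmult rho0 u0)) p + at3 (partial I2 M) p)
  + (at3 (partial I3 (B I1)) p + at3 (slow sigma) p * at3 (partial I3 (B I2)) p)).
{ intros p Hp hK.
  assert (xx := X p Hp).
  assert (xr := fun i => proj1 (xx i)).
  assert (xu := fun i => proj1 (proj2 (xx i))).
  assert (xK := fun i => proj1 (proj2 (proj2 (xx i)))).
  assert (xs := fun i => proj1 (proj2 (proj2 (proj2 (xx i))))).
  assert (xe := fun i => proj1 (proj2 (proj2 (proj2 (proj2 (xx i)))))).
  assert (xa := fun i => proj1 (proj2 (proj2 (proj2 (proj2 (proj2 (xx i))))))).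
  assert (xg := fun i => proj1 (proj2 (proj2 (proj2 (proj2 (proj2 (proj2 (xx i)))))))).
  assert (xR := fun i => proj2 (proj2 (proj2 (proj2 (proj2 (proj2 (proj2 (xx i)))))))).
  clear xx.
  assert (E1 := dE I1 p HK Hr Pos Hp); assert (E2 := dE I2 p HK Hr Pos Hp); simpl in E1, E2.
  change (at3 (Defs.d1 e) p) with (at3 (partial I1 e) p) in E1.
  rewrite Q2 by auto.
  change M with (fplus (fplus (fplus (fmult rho0 (fsq u0)) (fmult rho0 g))
    (fmult (fmult (slow K) (partial I3 rho0)) a)) (fopp e)).
  unfold en, H, m.
  rewrite partial_mult in hK by auto.
  rewrite !partial_plus, !partial_opp, !partial_mult, !partial_sq, !partial_const
    by auto 10 using ex_partial_plus, ex_partial_mult, ex_partial_sq, ex_partial_const,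
    ex_partial_opp.
  change (at3 (partial I1 e) p = at3 g p * at3 (partial I1 rho0) p + at3 (partial I1 (slow K))
      p * at3 (partial I3 rho0) p * at3 a p
     + at3 (partial I3 (B I1)) p) in E1.
  change (at3 (partial I2 e) p = at3 g p * at3 (partial I2 rho0) p + at3 (partial I2 (slow K))
      p * at3 (partial I3 rho0) p * at3 a p
     + at3 (partial I3 (B I2)) p) in E2.
  rewrite Rplus_comm in hK; apply Rplus_opp_r_uniq in hK.
  rewrite E1, E2, hK.
  unfold fplus, fmult, fopp, fsq, fconst, at3; field. }
intros T X' Hp.
assert (hK := proj1 (Havg T X' Hp)).
destruct (Havg T X' Hp) as [_ [A1 [A2 A3]]].
assert (cB := fun i => is_RInt_d3 (B i) T X' (expandable_C1 _ _ _ (EB i)) (expandable_periodic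
    _ _ _ (EB i)) Hp).
assert (P1 := fun f (Hf : expandable 1 (fun _ => f) f) => is_RInt_p1_mean f T X' (expandable_C1
    _ _ _ Hf) Hp).
assert (P2 := fun f (Hf : expandable 1 (fun _ => f) f) => is_RInt_p2_mean f T X' (expandable_C1
    _ _ _ Hf) Hp).
(* The multipliers H and m are constant over a period, so their values at th = 0 can be taken out of
   the averages. *)
assert (HC := phase_constant H T X' (expandable_C1 _ _ _ EH) Hp (fun th => H3 (T, X', th) Hp)).
assert (mC := phase_constant m T X' (expandable_C1 _ _ _ En) Hp (fun th => m3 (T, X', th) Hp)).
(* The integrand is the left side of [Id] minus its right side, hence zero; each block of the right
   side integrates to 0 by an averaged equation or by periodicity. *)
assert (I := is_RInt_Rplus _ _ _ _ _ _
  (is_RInt_Rplus _ _ _ _ _ _ (P1 en Een) (P2 Q EQ))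
  (is_RInt_Rmult _ _ _ (-1) _ (is_RInt_Rplus _ _ _ _ _ _
    (is_RInt_Rplus _ _ _ _ _ _
      (is_RInt_Rmult _ _ _ (H T X' 0) _ (is_RInt_Rplus _ _ _ _ _ _ (P1 _ (Er 1%nat)) (P2 _
      Em1)))
      (is_RInt_Rplus _ _ _ _ _ _
        (is_RInt_Rmult _ _ _ (m T X' 0) _ (is_RInt_Rplus _ _ _ _ _ _
          (is_RInt_Rplus _ _ _ _ _ _ (P1 _ (Eu 1%nat)) (P2 _ Ek)) (P2 _ Eg)))
        (is_RInt_Rmult _ _ _ (sigma T X') _ (is_RInt_Rplus _ _ _ _ _ _ (P1 _ Em1) (P2 M EM)))))
    (is_RInt_Rplus _ _ _ _ _ _ (cB I1) (is_RInt_Rmult _ _ _ (sigma T X') _ (cB I2)))))).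
apply is_RInt_zero in I.
- change (p1 (mean en) T X' + p2 (mean Q) T X' = 0).
  change (p1 (mean rho0) T X' + p2 (mean (fmult rho0 u0)) T X' = 0) in A1.
  change (p1 (mean u0) T X' + p2 (mean (fmult (fconst (/ 2)) (fsq u0))) T X' + p2 (mean g) T X'
      = 0) in A2.
  change (p1 (mean (fmult rho0 u0)) T X' + p2 (mean M) T X' = 0) in A3.
  rewrite A1, A2, A3 in I; lra.
- intros th; generalize (Id (T, X', th) Hp hK); unfold at3; simpl.
  rewrite (HC th), (mC th); unfold slow; intros E; rewrite E; ring.
Qed.

Lemma lagrange_energy_equation k j v0 w0 :
  smooth2 U k -> smooth2 U j -> smooth_profile U v0 -> smooth_profile U w0 ->
  positive_profile U v0 ->
  lagrange_profile_equations U F k j v0 w0 ->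
  lagrange_averaged_equations U F k j v0 w0 ->
  lagrange_energy_law U F k v0 w0.
Proof.
intros Hk Hj Hv Hw Hpos Hprof Havg.
assert (Pos : on (fun p => 0 < at3 v0 p)) by (intros [[S Y] th] Hp; exact (Hpos S Y th Hp)).
assert (Ev : forall n, expandable n (fun _ => v0) v0) by (intros; eexists; apply
    two_scale_profile, Hv).
assert (Ew : forall n, expandable n (fun _ => w0) w0) by (intros; eexists; apply
    two_scale_profile, Hw).
assert (Ek : forall n, expandable n (fun _ => slow k) (slow k)) by (intros; apply
    expandable_slow, Hk).
assert (Ej : forall n, expandable n (fun _ => slow j) (slow j)) by (intros; apply
    expandable_slow, Hj).
destruct (expandable_fixed_energy 1 k v0 Hk Hv Pos) as [EE [Ea Eg]].
assert (dE := fun i => partial_energy i k v0).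
set (g := variational_derivative (fast k) F v0) in *.
set (a := fcomp (p2 F) v0 (fast k v0)) in *.
set (e := fcomp F v0 (fast k v0)) in *.
assert (ER := expandable_partial 1 I3 _ _ (Ev 2%nat)).
assert (ERw := expandable_partial 1 I3 _ _ (Ew 2%nat)).
assert (Em := expandable_mult 1 _ _ _ _ (Ev _) (Ew _)).
assert (Eksq := expandable_mult 1 _ _ _ _ (expandable_const 1 (/ 2)) (expandable_sq 1 _ _ (Ew
    _))).
assert (Ep := expandable_opp 1 _ _ Eg).
assert (EB := fun i => expandable_mult 1 _ _ _ _ (expandable_mult 1 _ _ _ _ (Ek 1%nat) Ea)
    (expandable_partial 1 i _ _ (Ev 2%nat))).
assert (EM : expandable 1 (fun _ => lagrange_flux F (fast k) v0 w0) (lagrange_flux F (fast k)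
    v0 w0))
  by exact (expandable_plus 1 _ _ _ _ (expandable_plus 1 _ _ _ _ (expandable_plus 1 _ _ _ _
       (expandable_opp 1 _ _ Eksq) (expandable_mult 1 _ _ _ _ (Ev _) Ep)) EE)
       (expandable_opp 1 _ _ (expandable_mult 1 _ _ _ _ (expandable_mult 1 _ _ _ _ (Ek 1%nat)
       ER) Ea))).
assert (Een := expandable_plus 1 _ _ _ _ Eksq EE).
assert (EQ := expandable_plus 1 _ _ _ _ (expandable_mult 1 _ _ _ _ (Ew 1%nat) Ep)
   (expandable_opp 1 _ _ (expandable_mult 1 _ _ _ _ (expandable_mult 1 _ _ _ _ (Ek 1%nat) ERw)
       Ea))).
assert (EH := expandable_plus 1 _ _ _ _ Ep (expandable_mult 1 _ _ _ _ (Ej 1%nat) (Ew _))).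
assert (En := expandable_plus 1 _ _ _ _ (Ew 1%nat) (expandable_opp 1 _ _ (expandable_mult 1 _ _
    _ _ (Ej 1%nat) (Ev _)))).
set (M := lagrange_flux F (fast k) v0 w0) in *.
(* As p0 = - g, this H is p0 + j w0, the opposite of the multiplier of the volume equation. *)
set (H := fplus (fopp g) (fmult (slow j) w0)) in *.
set (n := fplus w0 (fopp (fmult (slow j) v0))) in *.
set (en := fplus (fmult (fconst (/ 2)) (fsq w0)) e) in *.
set (Q := fplus _ _) in EQ.
set (B := fun i => fmult (fmult (slow k) a) (partial i v0)) in *.
assert (X : forall p, U (fst p) -> forall i,
  ex_partial i v0 p /\ ex_partial i w0 p /\ ex_partial i (slow k) p /\ ex_partial i (slow j) p
      /\
  ex_partial i e p /\ ex_partial i a p /\ ex_partial i g p /\ ex_partial i (partial I3 v0) p).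
{ intros p Hp i; repeat split.
  - apply (expandable_ex_partial _ _ _ i (Ev 1%nat) p Hp).
  - apply (expandable_ex_partial _ _ _ i (Ew 1%nat) p Hp).
  - apply (expandable_ex_partial _ _ _ i (Ek 1%nat) p Hp).
  - apply (expandable_ex_partial _ _ _ i (Ej 1%nat) p Hp).
  - apply (expandable_ex_partial _ _ _ i EE p Hp).
  - apply (expandable_ex_partial _ _ _ i Ea p Hp).
  - apply (expandable_ex_partial _ _ _ i Eg p Hp).
  - apply (expandable_ex_partial _ _ _ i ER p Hp). }
assert (Prof : forall p, U (fst p) ->
  at3 (partial I3 w0) p = at3 (slow j) p * at3 (partial I3 v0) p /\
  at3 (slow j) p * at3 (partial I3 w0) p - at3 (partial I3 g) p = 0).
{ intros [[S Y] th] Hp; destruct (Hprof S Y th Hp) as [h1 h2]; split.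
  - apply Rminus_diag_uniq; exact h1.
  - unfold Rminus; rewrite <- partial_opp; exact h2. }
assert (H3 : forall p, U (fst p) -> at3 (partial I3 H) p = 0).
{ intros p Hp; destruct (Prof p Hp) as [_ h]; destruct (X p Hp I3) as (xv & xw & xk & xj & xe &
    xa & xg & xR).
  unfold H; rewrite partial_plus, partial_opp, partial_mult, partial_slow3 by auto using
      ex_partial_mult, ex_partial_opp.
  revert h; unfold at3; intros h; lra. }
assert (n3 : forall p, U (fst p) -> at3 (partial I3 n) p = 0).
{ intros p Hp; destruct (Prof p Hp) as [h _]; destruct (X p Hp I3) as (xv & xw & xk & xj & xe &
    xa & xg & xR).
  unfold n; rewrite partial_plus, partial_opp, partial_mult, partial_slow3 by auto using
      ex_partial_mult, ex_partial_opp.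
  revert h; unfold at3; intros h; lra. }
(* The volume profile equation turns d_theta w0 into j d_theta v0 in the energy flux before the slow
   derivative is taken. *)
assert (Q2 : forall p, U (fst p) -> at3 (partial I2 Q) p =
  at3 (partial I2 (fplus (fmult w0 (fopp g))
    (fopp (fmult (fmult (slow k) (fmult (slow j) (partial I3 v0))) a)))) p).
{ intros p Hp; apply partial_ext, on_locally; auto; intros q Hq; destruct (Prof q Hq) as [h _].
  exact (f_equal (fun z => at3 (fmult w0 (fopp g)) q + - (at3 (slow k) q * z * at3 a q)) h). }
(* In the wave equation and in the phase derivatives, - j takes the place of the Eulerian sigma,
   whereas the momentum multiplier is + j. *)
assert (Id : forall p, U (fst p) ->
  at3 (partial I1 (slow k)) p - at3 (partial I2 (fmult (slow j) (slow k))) p = 0 ->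
  at3 (partial I1 en) p + at3 (partial I2 Q) p =
  - at3 H p * (at3 (partial I1 v0) p - at3 (partial I2 w0) p)
  + at3 n p * (at3 (partial I1 w0) p + at3 (partial I2 (fopp g)) p)
  + at3 (slow j) p * (at3 (partial I1 (fmult v0 w0)) p + at3 (partial I2 M) p)
  + (at3 (partial I3 (B I1)) p - at3 (slow j) p * at3 (partial I3 (B I2)) p)).
{ intros p Hp hk.
  assert (xx := X p Hp).
  assert (xv := fun i => proj1 (xx i)).
  assert (xw := fun i => proj1 (proj2 (xx i))).
  assert (xk := fun i => proj1 (proj2 (proj2 (xx i)))).
  assert (xj := fun i => proj1 (proj2 (proj2 (proj2 (xx i))))).
  assert (xe := fun i => proj1 (proj2 (proj2 (proj2 (proj2 (xx i)))))).
  assert (xa := fun i => proj1 (proj2 (proj2 (proj2 (proj2 (proj2 (xx i))))))).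
  assert (xg := fun i => proj1 (proj2 (proj2 (proj2 (proj2 (proj2 (proj2 (xx i)))))))).
  assert (xR := fun i => proj2 (proj2 (proj2 (proj2 (proj2 (proj2 (proj2 (xx i)))))))).
  clear xx.
  assert (E1 := dE I1 p Hk Hv Pos Hp); assert (E2 := dE I2 p Hk Hv Pos Hp); simpl in E1, E2.
  change (at3 (partial I1 e) p = at3 g p * at3 (partial I1 v0) p + at3 (partial I1 (slow k)) p
      * at3 (partial I3 v0) p * at3 a p
     + at3 (partial I3 (B I1)) p) in E1.
  change (at3 (partial I2 e) p = at3 g p * at3 (partial I2 v0) p + at3 (partial I2 (slow k)) p
      * at3 (partial I3 v0) p * at3 a p
     + at3 (partial I3 (B I2)) p) in E2.
  rewrite Q2 by auto.
  change M with (fplus (fplus (fplus (fopp (fmult (fconst (/ 2)) (fsq w0))) (fmult v0 (fopp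
      g))) e)
    (fopp (fmult (fmult (slow k) (partial I3 v0)) a))).
  unfold en, H, n.
  rewrite partial_mult in hk by auto; apply Rminus_diag_uniq in hk.
  rewrite !partial_plus, !partial_opp, !partial_mult, !partial_opp, !partial_sq, !partial_const
    by auto 10 using ex_partial_plus, ex_partial_mult, ex_partial_sq, ex_partial_const,
    ex_partial_opp.
  rewrite E1, E2, hk.
  unfold fplus, fmult, fopp, fsq, fconst, at3; field. }
intros S Y Hp.
assert (hk := proj1 (Havg S Y Hp)).
destruct (Havg S Y Hp) as [_ [A1 [A2 A3]]].
assert (cB := fun i => is_RInt_d3 (B i) S Y (expandable_C1 _ _ _ (EB i)) (expandable_periodic _
    _ _ (EB i)) Hp).
assert (P1 := fun f (Hf : expandable 1 (fun _ => f) f) => is_RInt_p1_mean f S Y (expandable_C1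
    _ _ _ Hf) Hp).
assert (P2 := fun f (Hf : expandable 1 (fun _ => f) f) => is_RInt_p2_mean f S Y (expandable_C1
    _ _ _ Hf) Hp).
assert (HC := phase_constant H S Y (expandable_C1 _ _ _ EH) Hp (fun th => H3 (S, Y, th) Hp)).
assert (nC := phase_constant n S Y (expandable_C1 _ _ _ En) Hp (fun th => n3 (S, Y, th) Hp)).
assert (I := is_RInt_Rplus _ _ _ _ _ _
  (is_RInt_Rplus _ _ _ _ _ _ (P1 en Een) (P2 Q EQ))
  (is_RInt_Rmult _ _ _ (-1) _ (is_RInt_Rplus _ _ _ _ _ _
    (is_RInt_Rplus _ _ _ _ _ _
      (is_RInt_Rmult _ _ _ (- H S Y 0) _ (is_RInt_Rplus _ _ _ _ _ _ (P1 _ (Ev 1%nat))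
         (is_RInt_Rmult _ _ _ (-1) _ (P2 _ (Ew 1%nat)))))
      (is_RInt_Rplus _ _ _ _ _ _
        (is_RInt_Rmult _ _ _ (n S Y 0) _ (is_RInt_Rplus _ _ _ _ _ _ (P1 _ (Ew 1%nat)) (P2 _
        Ep)))
        (is_RInt_Rmult _ _ _ (j S Y) _ (is_RInt_Rplus _ _ _ _ _ _ (P1 _ Em) (P2 M EM)))))
    (is_RInt_Rplus _ _ _ _ _ _ (cB I1) (is_RInt_Rmult _ _ _ (- j S Y) _ (cB I2)))))).
apply is_RInt_zero in I.
- change (p1 (mean en) S Y + p2 (mean Q) S Y = 0).
  change (p1 (mean w0) S Y + p2 (mean (fopp g)) S Y = 0) in A2.
  change (p1 (mean (fmult v0 w0)) S Y + p2 (mean M) S Y = 0) in A3.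
  replace (p1 (mean v0) S Y + -1 * p2 (mean w0) S Y) with 0 in I by lra.
  rewrite A2, A3 in I; lra.
- intros th; generalize (Id (S, Y, th) Hp hk); unfold at3; simpl.
  rewrite (HC th), (nC th); unfold slow; intros E; rewrite E; ring.
Qed.

End Energy.

End Families.

Theorem proposition1 (E e : R -> R -> R)
    (E_smooth : smooth_energy E) (e_smooth : smooth_energy e)
    (E_of_e : forall rho rho_x : R, 0 < rho ->
       E rho rho_x = rho * e (/ rho) (- rho_x / rho ^ 3))
    (U : R * R -> Prop) (U_open : open U) :
  (* (i) Eulerian framework *)
  ((forall (Phi : R -> R -> R) (rho0 u0 rho1 u1 : field) (rho u : R -> field),
      euler_expansion E U Phi rho0 u0 rho1 u1 rho u ->
      let K := p2 Phi in
      let sigma := fun T X => - p1 Phi T X / K T X in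
      euler_profile_equations U E K sigma rho0 u0 /\
      euler_averaged_equations U E K sigma rho0 u0) /\
   (forall (K sigma : R -> R -> R) (rho0 u0 : field),
      smooth2 U K -> smooth2 U sigma ->
      smooth_profile U rho0 -> smooth_profile U u0 ->
      (forall T X, U (T, X) -> K T X <> 0) -> positive_profile U rho0 ->
      euler_profile_equations U E K sigma rho0 u0 ->
      euler_averaged_equations U E K sigma rho0 u0 ->
      euler_energy_law U E K rho0 u0)) /\
  (* (ii) mass Lagrangian framework *)
  ((forall (phi : R -> R -> R) (v0 w0 v1 w1 : field) (v w : R -> field),
      lagrange_expansion e U phi v0 w0 v1 w1 v w ->
      let k := p2 phi in
      let j := fun S Y => p1 phi S Y / k S Y in
      lagrange_profile_equations U e k j v0 w0 /\
      lagrange_averaged_equations U e k j v0 w0) /\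
   (forall (k j : R -> R -> R) (v0 w0 : field),
      smooth2 U k -> smooth2 U j ->
      smooth_profile U v0 -> smooth_profile U w0 ->
      (forall S Y, U (S, Y) -> k S Y <> 0) -> positive_profile U v0 ->
      lagrange_profile_equations U e k j v0 w0 ->
      lagrange_averaged_equations U e k j v0 w0 ->
      lagrange_energy_law U e k v0 w0)).
Proof.
split; split.
- intros; eapply euler_expansion_equations; eassumption.
- intros; eapply euler_energy_equation; eassumption.
- intros; eapply lagrange_expansion_equations; eassumption.
- intros; eapply lagrange_energy_equation; eassumption.
Qed.
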